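(* For $n\ge 2$ let $P_n$ be the set of all primes of binary length $n$. Assume that for every real $r>0$ and every sequence $\{C_n\}_{n\in\mathbb{N}}$ of Boolean circuits of size polynomial in $n$ there is an $n\ge 2$ such that $$\Pr_{p,q\sim P_n}[C_n(pq)\in\{p,q\}]<r,$$ where $p,q$ are sampled uniformly and independently from $P_n$. Then $$T_{\mathrm{PV}}\nvdash \textsc{PrimeFactor}.$$
   Context: Numbers are identified with binary strings. The circuit $C_n$ takes (the binary representation of) the number $pq$ as input and outputs (the binary representation of) a number. $\mathrm{PV}$ is a first-order language containing a function symbol $f_M$ for every polynomial-time clocked Turing machine $M$; the intended interpretation of $f_M$ in $\mathbb{N}$ is the function on natural numbers computed by $M$. A polynomial-time predicate is treated as the atomic formula $g(x_1,\dots,x_k)=1$, where $g$ is a function symbol in $\mathrm{PV}$; in particular $\le$ and the divisibility relation $\mid$ are available in this way. $T_{\mathrm{PV}}$ is the theory axiomatized by all universal $\mathrm{PV}$-sentences true in $\mathbb{N}$. $\textsc{PrimeFactor}$ is the $\mathrm{PV}$-sentence $$(\forall x\geq 2)(\exists y\leq x)(\forall z\leq y)\bigl((2\le y)\land (y\mid x)\land (z\mid y\to (z=1\lor z=y))\bigr).$$ *)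

(* Defs.v *)
From mathcomp Require Import all_boot all_order all_algebra.
From mathcomp Require Import boolp classical_sets reals.

Set Implicit Arguments.
Unset Strict Implicit.
Unset Printing Implicit Defensive.

(* All binary strings are written least significant bit first. [binlen 0 = 0],
   and [binlen n = trunc_log 2 n + 1] for [n > 0]. *)
Definition binlen (n : nat) : nat := up_log 2 n.+1.

Definition bit (n i : nat) : bool := odd (n %/ 2 ^ i).

Definition bits (n : nat) : seq bool := mkseq (bit n) (binlen n).

(* High-order zeros are allowed in [s]. *)
Definition bits_val (s : seq bool) : nat :=
  foldr (fun (b : bool) v => b + v.*2) 0 s.

(* Wire [i] is the [i]-th input if [i < k], and the [(i - k)]-th gate
   otherwise. *)
Variant gate : Type :=
  | GConst of bool
  | GNot of nat
  | GAnd of nat & nat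
  | GOr of nat & nat.

Definition gate_wf (w : nat) (g : gate) : bool :=
  match g with
  | GConst _ => true
  | GNot i => i < w
  | GAnd i j | GOr i j => (i < w) && (j < w)
  end.

Fixpoint gates_wf (w : nat) (gs : seq gate) : bool :=
  if gs is g :: gs' then gate_wf w g && gates_wf w.+1 gs' else true.

Record circuit (k : nat) : Type := Circuit {
  gates : seq gate;
  outputs : seq nat;
  gatesP : gates_wf k gates;
  outputsP : all (fun i => i < k + size gates) outputs
}.

Definition circuit_size (k : nat) (C : circuit k) : nat :=
  k + size (gates C) + size (outputs C).

Definition gate_val (vs : seq bool) (g : gate) : bool :=
  match g with
  | GConst b => b
  | GNot i => ~~ nth false vs i
  | GAnd i j => nth false vs i && nth false vs j
  | GOr i j => nth false vs i || nth false vs j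
  end.

Definition circuit_run (k : nat) (C : circuit k) (x : k.-tuple bool) :
    seq bool :=
  let vs := foldl (fun vs g => rcons vs (gate_val vs g)) x (gates C) in
  [seq nth false vs i | i <- outputs C].

(* Meant for [m < 2 ^ k], whose binary representation is padded to length
   [k]. *)
Definition circuit_num (k : nat) (C : circuit k) (m : nat) : nat :=
  bits_val (circuit_run C [tuple bit m i | i < k]).

Definition poly_size (k : nat -> nat) (C : forall n, circuit (k n)) : Prop :=
  exists c : nat, forall n, circuit_size (C n) <= n ^ c + c.

Definition primes_of_len (n : nat) : {set 'I_(2 ^ n)} :=
  [set p : 'I_(2 ^ n) | prime p && (binlen p == n)].

(* The product of two numbers of length [n] has length at most [2n]. *)
Definition factor_prob (R : realType) (n : nat) (C : circuit n.*2) : R :=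
  (#|[set pq in finset.setX (primes_of_len n) (primes_of_len n)
       | circuit_num C (pq.1 * pq.2)%N \in [:: val pq.1; val pq.2]]|%:R
   / #|finset.setX (primes_of_len n) (primes_of_len n)|%:R)%R.

(* [None] is the blank, [Some (inl b)] the bit [b], and [Some (inr a)] a
   further symbol of the machine. *)
Definition symbol (a : nat) : Type := option (bool + 'I_a).

Variant move : Type := MLeft | MStay | MRight.

(* Deterministic Turing machine with [k] input tapes and [tm_work.+1] further
   tapes, the first of which is the output tape. All tapes are read/write and
   infinite to the right. The machine halts when [tm_delta] returns [None]. *)
Record tm (k : nat) : Type := TM {
  tm_states : nat;
  tm_extra : nat;
  tm_work : nat;
  tm_delta :
    {ffun 'I_tm_states.+1 * {ffun 'I_(k + tm_work.+1) -> symbol tm_extra} ->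
       option ('I_tm_states.+1 *
               {ffun 'I_(k + tm_work.+1) -> symbol tm_extra * move})}
}.

(* Cell contents, blank beyond the end of the sequence, and head position. *)
Definition tape (a : nat) : Type := seq (symbol a) * nat.

Definition tape_read (a : nat) (t : tape a) : symbol a := nth None t.1 t.2.

(* A left move from the leftmost cell leaves the head in place. *)
Definition tape_act (a : nat) (t : tape a) (sm : symbol a * move) : tape a :=
  (set_nth None t.1 t.2 sm.1,
   match sm.2 with MLeft => t.2.-1 | MStay => t.2 | MRight => t.2.+1 end).

Definition config (k : nat) (M : tm k) : Type :=
  'I_(tm_states M).+1 * {ffun 'I_(k + (tm_work M).+1) -> tape (tm_extra M)}.

Definition tm_init (k : nat) (M : tm k) (x : {ffun 'I_k -> nat}) : config M :=
  (ord0, [ffun i => match split i with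
                    | inl j => ([seq Some (inl b) | b <- bits (x j)], 0)
                    | inr _ => ([::], 0)
                    end]).

Definition tm_step (k : nat) (M : tm k) (c : config M) : config M :=
  if tm_delta M (c.1, [ffun i => tape_read (c.2 i)]) is Some (q, act)
  then (q, [ffun i => tape_act (c.2 i) (act i)])
  else c.

(* The output string extends up to the first cell not containing a bit. *)
Fixpoint leading_bits (a : nat) (s : seq (symbol a)) : seq bool :=
  if s is Some (inl b) :: s' then b :: leading_bits s' else [::].

Definition tm_output (k : nat) (M : tm k) (c : config M) : nat :=
  bits_val (leading_bits (c.2 (rshift k ord0)).1).

(* A machine together with a clock, which stops it after [l ^ c + c] steps on
   inputs of total length [l], unless it has halted before. *)
Record PV (k : nat) : Type := Clocked {
  pv_machine : tm k;
  pv_clock : nat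
}.

Definition pv_fun (k : nat) (f : PV k) (x : {ffun 'I_k -> nat}) : nat :=
  let l := \sum_(i < k) binlen (x i) in
  tm_output (iter (l ^ pv_clock f + pv_clock f) (@tm_step k (pv_machine f))
                  (tm_init (pv_machine f) x)).

(* First-order logic with equality over a language without relation symbols;
   [F k] is the type of function symbols of arity [k]. Variables are de Bruijn
   indices. *)
Section FirstOrder.
Variable F : nat -> Type.

Inductive term : Type :=
  | Var of nat
  | App k of F k & {ffun 'I_k -> term}.

Inductive formula : Type :=
  | FEq of term & term
  | FBot
  | FImp of formula & formula
  | FAnd of formula & formula
  | FOr of formula & formula
  | FAll of formula
  | FEx of formula.

Definition FNot (A : formula) : formula := FImp A FBot.

Fixpoint tsubst (s : nat -> term) (t : term) : term :=
  match t with
  | Var n => s n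
  | App k f a => App f [ffun i => tsubst s (a i)]
  end.

Definition scons (T : Type) (x : T) (s : nat -> T) (n : nat) : T :=
  if n is m.+1 then s m else x.

Definition tshift : term -> term := tsubst (fun n => Var n.+1).

Definition up (s : nat -> term) : nat -> term :=
  scons (Var 0) (fun n => tshift (s n)).

Fixpoint fsubst (s : nat -> term) (A : formula) : formula :=
  match A with
  | FEq t u => FEq (tsubst s t) (tsubst s u)
  | FBot => FBot
  | FImp A B => FImp (fsubst s A) (fsubst s B)
  | FAnd A B => FAnd (fsubst s A) (fsubst s B)
  | FOr A B => FOr (fsubst s A) (fsubst s B)
  | FAll A => FAll (fsubst (up s) A)
  | FEx A => FEx (fsubst (up s) A)
  end.

Definition fshift : formula -> formula := fsubst (fun n => Var n.+1).

Definition inst (t : term) : formula -> formula := fsubst (scons t Var).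

(* Every free variable has index less than [n]. *)
Fixpoint tbounded (n : nat) (t : term) : bool :=
  match t with
  | Var m => m < n
  | App k f a => [forall i, tbounded n (a i)]
  end.

Fixpoint fbounded (n : nat) (A : formula) : bool :=
  match A with
  | FEq t u => tbounded n t && tbounded n u
  | FBot => true
  | FImp A B | FAnd A B | FOr A B => fbounded n A && fbounded n B
  | FAll A | FEx A => fbounded n.+1 A
  end.

Definition sentence (A : formula) : bool := fbounded 0 A.

Fixpoint quantifier_free (A : formula) : bool :=
  match A with
  | FEq _ _ | FBot => true
  | FImp A B | FAnd A B | FOr A B => quantifier_free A && quantifier_free B
  | FAll _ | FEx _ => false
  end.

Definition universal (A : formula) : Prop :=
  exists n B, quantifier_free B /\ A = iter n FAll B.

Local Open Scope classical_set_scope.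

(* Classical natural deduction. Sets of hypotheses may be infinite and may
   contain free variables; derivations use finitely many hypotheses. *)
Inductive proves : set formula -> formula -> Prop :=
  | P_ax G A : G A -> proves G A
  | P_raa G A : proves (FNot A |` G) FBot -> proves G A
  | P_impI G A B : proves (A |` G) B -> proves G (FImp A B)
  | P_impE G A B : proves G (FImp A B) -> proves G A -> proves G B
  | P_andI G A B : proves G A -> proves G B -> proves G (FAnd A B)
  | P_andE1 G A B : proves G (FAnd A B) -> proves G A
  | P_andE2 G A B : proves G (FAnd A B) -> proves G B
  | P_orI1 G A B : proves G A -> proves G (FOr A B)
  | P_orI2 G A B : proves G B -> proves G (FOr A B)
  | P_orE G A B C : proves G (FOr A B) ->
      proves (A |` G) C -> proves (B |` G) C -> proves G C
  | P_allI G A : proves (fshift @` G) A -> proves G (FAll A)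
  | P_allE G A t : proves G (FAll A) -> proves G (inst t A)
  | P_exI G A t : proves G (inst t A) -> proves G (FEx A)
  | P_exE G A B : proves G (FEx A) ->
      proves (A |` (fshift @` G)) (fshift B) -> proves G B
  | P_eqI G t : proves G (FEq t t)
  | P_eqE G A t u : proves G (FEq t u) ->
      proves G (inst t A) -> proves G (inst u A).

Section Semantics.
Variables (D : Type) (I : forall k, F k -> {ffun 'I_k -> D} -> D).

Fixpoint eval (v : nat -> D) (t : term) : D :=
  match t with
  | Var n => v n
  | App k f a => I f [ffun i => eval v (a i)]
  end.

Fixpoint sat (v : nat -> D) (A : formula) : Prop :=
  match A with
  | FEq t u => eval v t = eval v u
  | FBot => False
  | FImp A B => sat v A -> sat v B
  | FAnd A B => sat v A /\ sat v B
  | FOr A B => sat v A \/ sat v B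
  | FAll A => forall x, sat (scons x v) A
  | FEx A => exists x, sat (scons x v) A
  end.

Definition holds (A : formula) : Prop := forall v, sat v A.

End Semantics.
End FirstOrder.

Arguments Var {F}.
Arguments FBot {F}.

(* The true universal PV-sentences. *)
Definition T_PV : set (formula PV) :=
  [set A | [/\ sentence A, universal A & holds pv_fun A]]%classic.

Definition args (T : Type) (k : nat) (t : k.-tuple T) : {ffun 'I_k -> T} :=
  [ffun i => tnth t i].

(* [c] is a constant symbol for the number [m]. *)
Definition denotes (c : PV 0) (m : nat) : Prop := pv_fun c (args [tuple]) = m.

(* The atomic formula [g(x, y) = 1] expresses the relation [P]. *)
Definition expresses (g : PV 2) (P : nat -> nat -> bool) : Prop :=
  forall x y, pv_fun g (args [tuple x; y]) = 1 <-> P x y.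

Definition const (c : PV 0) : term PV := App c (args [tuple]).

Definition atom (one : PV 0) (g : PV 2) (t u : term PV) : formula PV :=
  FEq (App g (args [tuple t; u])) (const one).

(* In the innermost scope the variables 2, 1 and 0 stand for x, y and z. The
   sentence depends on the symbols chosen for 1, 2, [<=] and divisibility. *)
Definition PrimeFactor (one two : PV 0) (le dvd : PV 2) : formula PV :=
  FAll (FImp (atom one le (const two) (Var 0))
    (FEx (FAnd (atom one le (Var 0) (Var 1))
      (FAll (FImp (atom one le (Var 0) (Var 1))
        (FAnd (atom one le (const two) (Var 1))
        (FAnd (atom one dvd (Var 1) (Var 2))
              (FImp (atom one dvd (Var 0) (Var 1))
                    (FOr (FEq (Var 0) (const one))
                         (FEq (Var 0) (Var 1))))))))))).

(* Main.v *)
Require Import Defs.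
From mathcomp Require Import all_boot all_order all_algebra.
From mathcomp Require Import boolp classical_sets filter reals.
From mathcomp Require Import zify.
From Stdlib Require List.

Set Implicit Arguments.
Unset Strict Implicit.
Unset Printing Implicit Defensive.

(** A proof of PrimeFactor in a universal theory would yield a student who,
computing with functions of PV, finds a prime factor of any [x] in boundedly
many rounds against a teacher: the student proposes a candidate [y], and the
teacher answers with a number [z] that refutes it. The type [play] consists of
the terms that describe such a game, [Reply d] being the answer to the
candidate [d]. If every finite set of candidates can be refuted at once in the
natural numbers, then an ultraproduct of the refutations is a model of [T_PV]
in which [Start] has no prime factor; this is [unprovable_PrimeFactor]. So it
suffices to find, for every finite list of plays, an [x] and a teacher who
refutes them.

The teacher takes for [x] a product of [2 ^ k] distinct primes of length [n],
placed at the leaves of a binary tree of height [k], where [k] exceeds the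
nesting depth of replies in the list. The nodes of level [i] cut the leaves
into blocks. A candidate which depends on [i] nested replies and is the product
over a union [S] of blocks of level [i] is refuted by the product over a block
of level [i + 1] inside [S] ([answer_refutes]). Hence the teacher is beaten
only by a candidate that is a product over a set containing [a] but not [b],
for two leaves [a] and [b] of a common block of level [i].

Such a candidate factors the product of the primes at [a] and [b]. The replies
that it depends on are 0 or products over sets which contain both [a] and [b]
or neither. So they depend on these two primes through their product [N] only,
and the candidate is computed from [N] by a circuit of polynomial size in which
the other primes are hardwired ([poly_computed_outcome]). Its value is the
prime at [a] times a known odd number [D], and exact division by [D] is
multiplication by the inverse of [D] modulo [2 ^ n] ([factor_circuit]).

If the teacher is beaten for all choices of the primes, then one of boundedly
many triples (candidate, [S], pair of leaves) occurs for a constant fraction of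
the choices, and by averaging the primes off the two leaves can be fixed
([averaging]). This gives circuits that succeed with probability bounded below
([factoring_circuits]), against the hypothesis. Coinciding primes are rare if
there are many primes of length [n]; if there are few, a fixed prime is a good
guess. That there is a prime of every length at least 2 follows from Bertrand's
postulate for powers of two ([prime_between_exp2]); for a length without primes
the success probability would be [0 / 0 = 0].

The remaining ingredient, [pv_fun_derives], says that functions of PV have
circuits of polynomial size, obtained by unrolling Turing machines. *)

(** * Soundness when equality is interpreted by a congruence *)

Lemma term_nested_ind (F : nat -> Type) (P : term F -> Prop) :
  (forall n, P (Var n)) ->
  (forall k (f : F k) (a : {ffun 'I_k -> term F}),
     (forall i, P (a i)) -> P (App f a)) ->
  forall t, P t.
Proof.
move=> HV HA; fix IH 1 => -[n|k f a]; first exact: HV.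
by apply: HA => i; apply: IH.
Qed.

Section Soundness.
Variables (F : nat -> Type) (D : Type) (I : forall k, F k ->
  {ffun 'I_k -> D} -> D).
Variable E : D -> D -> Prop.
Hypothesis Erefl : forall x, E x x.
Hypothesis Esym : forall x y, E x y -> E y x.
Hypothesis Etrans : forall x y z, E x y -> E y z -> E x z.
Hypothesis Econg : forall k (f : F k) (a b : {ffun 'I_k -> D}),
  (forall i, E (a i) (b i)) -> E (I f a) (I f b).

(** Equality is interpreted by a congruence [E], which saves forming the
quotient of the domain. *)
Fixpoint sat_mod (v : nat -> D) (A : formula F) : Prop :=
  match A with
  | FEq t u => E (eval I v t) (eval I v u)
  | FBot => False
  | FImp A B => sat_mod v A -> sat_mod v B
  | FAnd A B => sat_mod v A /\ sat_mod v B
  | FOr A B => sat_mod v A \/ sat_mod v B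
  | FAll A => forall x, sat_mod (scons x v) A
  | FEx A => exists x, sat_mod (scons x v) A
  end.

Lemma eval_tsubst s v t :
  eval I v (tsubst s t) = eval I (fun n => eval I v (s n)) t.
Proof.
elim/term_nested_ind: t => //= k f a IH; congr I.
by apply/ffunP => i; rewrite !ffunE IH.
Qed.

Lemma sat_mod_subst s v A :
  sat_mod v (fsubst s A) <-> sat_mod (fun n => eval I v (s n)) A.
Proof.
have scons_up s' v' x :
    (fun n => eval I (scons x v') (up s' n))
      = scons x (fun n => eval I v' (s' n)).
  by apply: funext => -[|n] //=; rewrite /up /= eval_tsubst.
elim: A s v => [t u| |A IA B IB|A IA B IB|A IA B IB|A IA|A IA] s v /=.
- by rewrite !eval_tsubst.
- by [].
- by rewrite IA IB.
- by rewrite IA IB.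
- by rewrite IA IB.
- by split=> H x; move: (H x); rewrite IA scons_up.
- by split=> -[x Hx]; exists x; move: Hx; rewrite IA scons_up.
Qed.

Lemma eval_mod v w t : (forall n, E (v n) (w n)) -> E (eval I v t) (eval I w t).
Proof.
move=> vw; elim/term_nested_ind: t => //= k f a IH.
by apply: Econg => i; rewrite !ffunE.
Qed.

(** This is what makes the substitution of equals for equals sound. *)
Lemma sat_mod_congr v w A :
  (forall n, E (v n) (w n)) -> sat_mod v A -> sat_mod w A.
Proof.
move=> vw; suff: sat_mod v A <-> sat_mod w A by case.
elim: A v w vw => [t u| |A IA B IB|A IA B IB|A IA B IB|A IA|A IA] v w vw /=.
- have [tE uE] := (eval_mod t vw, eval_mod u vw); split=> H.
    exact: Etrans (Esym tE) (Etrans H uE).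
  exact: Etrans tE (Etrans H (Esym uE)).
- by [].
- by rewrite (IA v w) // (IB v w).
- by rewrite (IA v w) // (IB v w).
- by rewrite (IA v w) // (IB v w).
- by split=> H x; move: (H x); rewrite (IA (scons x v) (scons x w)) // => -[].
- by split=> -[x Hx]; exists x; move: Hx;
    rewrite (IA (scons x v) (scons x w)) // => -[].
Qed.

Lemma sat_mod_inst v t A :
  sat_mod v (inst t A) <-> sat_mod (scons (eval I v t) v) A.
Proof.
rewrite /inst sat_mod_subst.
suff -> : (fun n => eval I v (scons t Var n)) = scons (eval I v t) v by [].
by apply: funext => -[].
Qed.

Lemma sat_mod_shift v x A : sat_mod (scons x v) (fshift A) <-> sat_mod v A.
Proof. exact: sat_mod_subst. Qed.

Lemma proves_sound G A : proves G A ->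
  forall v, (forall B, G B -> sat_mod v B) -> sat_mod v A.
Proof.
elim=> {G A} [G A GA|G A _ IH|G A B _ IH|G A B _ IA _ IB|G A B _ IA _ IB
  |G A B _ IH|G A B _ IH|G A B _ IH|G A B _ IH|G A B C _ IH _ IA _ IB
  |G A _ IH|G A t _ IH|G A t _ IH|G A B _ IA _ IB|G t|G A t u _ IE _ IA] v hG
    /=.
- exact: hG.
- by apply: contrapT => nA; apply: (IH v) => B [->|/hG].
- by move=> hA; apply: IH => C [->|/hG].
- exact: (IA v hG) (IB v hG).
- by split; [apply: IA | apply: IB].
- by case: (IH v hG).
- by case: (IH v hG).
- by left; apply: IH.
- by right; apply: IH.
- by case: (IH v hG) => h;
  [apply: IA => D' [->|/hG] | apply: IB => D' [->|/hG]].
- by move=> x; apply: IH => _ [B GB <-]; apply/sat_mod_shift/hG.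
- by apply/sat_mod_inst; apply: (IH v hG).
- by exists (eval I v t); apply/sat_mod_inst/IH.
- have [x hx] := IA v hG.
  apply/(@sat_mod_shift v x); apply: IB => C [->//|[C' GC' <-]].
  by apply/sat_mod_shift/hG.
- exact: Erefl.
- apply/sat_mod_inst.
  have /sat_mod_inst := IA v hG; apply: sat_mod_congr => -[|n] //=.
  exact: IE.
Qed.

End Soundness.

(** * Plays of the student against the teacher, and their ultraproducts *)

(** The closed terms over the functions of PV, a constant for [x] and a Skolem
function for the negation of PrimeFactor. *)
Inductive play : Type :=
  | Start
  | Reply of play
  | Apply k of PV k & {ffun 'I_k -> play}.

Lemma play_nested_ind (P : play -> Prop) :
  P Start -> (forall d, P d -> P (Reply d)) ->
  (forall k (f : PV k) (a : {ffun 'I_k -> play}),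
     (forall i, P (a i)) -> P (Apply f a)) ->
  forall d, P d.
Proof.
move=> HS HR HA; fix IH 1 => -[|d|k f a]; first exact: HS.
- by apply: HR; apply: IH.
- by apply: HA => i; apply: IH.
Qed.

(** The assignments of numbers to plays that respect the meaning of the
function symbols; replies are unconstrained. *)
Definition run (e : play -> nat) : Prop :=
  forall k (f : PV k) (a : {ffun 'I_k -> play}),
    e (Apply f a) = pv_fun f [ffun i => e (a i)].

(** The negation of the matrix of PrimeFactor. *)
Definition refutes (x y z : nat) : bool :=
  (y <= x) ==> (z <= y) && ~~ [&& 2 <= y, y %| x & (z %| y) ==> (z == 1) ||
    (z == y)].

Section Ultraproduct.
Local Open Scope classical_set_scope.
Variable U : set_system (play -> nat).
Hypothesis UU : UltraFilter U.
Hypothesis Urun : U [set e | run e].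

(* Plays are their own denotations; only the equality [ueq] depends on [U]. *)
Let IU (k : nat) (f : PV k) (a : {ffun 'I_k -> play}) := Apply f a.
Definition ueq (d d' : play) : Prop := U [set e | e d = e d'].

Lemma eval_run v t e : run e ->
  e (eval IU v t) = eval pv_fun (fun n => e (v n)) t.
Proof.
move=> re; elim/term_nested_ind: t => //= k f a IH.
by rewrite /IU re; congr pv_fun; apply/ffunP => i; rewrite !ffunE IH.
Qed.

Lemma ultra_imp (A B : set (play -> nat)) :
  (U A -> U B) <-> U [set e | A e -> B e].
Proof.
split=> [|AB UA].
- case: (in_ultra_setVsetC A UU) => [UA /(_ UA) UB|UnA _].
    by apply: filterS UB => e Be _.
  by apply: filterS UnA => e nA /nA.
- by apply: filterS2 UA AB => e Ae; apply.
Qed.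

Lemma ultra_or (A B : set (play -> nat)) :
  (U A \/ U B) <-> U [set e | A e \/ B e].
Proof.
split=> [[]|H]; [by apply: filterS => e; left | by apply: filterS => e;
  right |].
case: (in_ultra_setVsetC A UU) => [UA|UnA]; [by left|right].
by apply: filterS2 UnA H => e nA [/nA[]|].
Qed.

(** The theorem of Los. It is restricted to quantifier-free formulas because
the domain consists of plays, and a witness chosen separately for each run need
not be given by a play. *)
Lemma los v A : quantifier_free A ->
  sat_mod IU ueq v A <-> U [set e | sat pv_fun (fun n => e (v n)) A].
Proof.
elim: A => [t u _| |A IA B IB|A IA B IB|A IA B IB|//|//] /=.
- split=> H; apply: filterS2 Urun H => e re /=; by rewrite !eval_run.
- by split=> // /filter_not_empty.
- by case/andP=> /IA-> /IB->; apply: ultra_imp.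
- case/andP=> /IA-> /IB->; split=> [[]|H]; first exact: filterI.
  by split; apply: filterS H => e [].
- by case/andP=> /IA-> /IB->; apply: ultra_or.
Qed.

(** Instances of a universal sentence by plays become instances by numbers in
every run. *)
Lemma sat_universal A v : universal A -> holds pv_fun A -> sat_mod IU ueq v A.
Proof.
case=> n [B [qB ->]]; elim: n v => [|n IH] v /= hB.
  by apply/los => //; apply: filterS Urun => e _; apply: hB.
move=> x; apply: IH => w; have := hB (fun n => w n.+1) (w 0).
by congr sat; apply: funext => -[].
Qed.

Lemma proves_T_PV_ultra v A : proves T_PV A -> sat_mod IU ueq v A.
Proof.
move/proves_sound; apply=> [x|x y xy|x y z xy yz|k f a b ab|B [_ uB hB]].
- by apply: filterS Urun.
- by apply: filterS xy => e /= ->.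
- by apply: filterS2 xy yz => e /= -> ->.
- have: U [set e | forall i, e (a i) = e (b i)].
    exact: (filter_forall (f := fun i e => e (a i) = e (b i)) _ ab).
  rewrite /ueq; apply: filterS2 Urun => e re eab /=; rewrite /IU !re.
  by congr pv_fun; apply/ffunP => i; rewrite !ffunE; apply: eab.
- exact: sat_universal.
Qed.

End Ultraproduct.

Lemma eval_atom (one : PV 0) (g : PV 2) (P : nat -> nat -> bool) v t u :
  denotes one 1 -> expresses g P ->
  sat pv_fun v (atom one g t u) <-> P (eval pv_fun v t) (eval pv_fun v u).
Proof.
move=> h1 hg; rewrite -hg /=.
have -> : [ffun i => eval pv_fun v (args [tuple] i)] = args [tuple].
  by apply/ffunP => -[].
rewrite h1; suff -> : [ffun i => eval pv_fun v (args [tuple t; u] i)] =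
   args [tuple eval pv_fun v t; eval pv_fun v u] by [].
by apply/ffunP => i; rewrite !ffunE !(tnth_nth (Var 0)) !(tnth_nth 0);
  case: i => -[|[|]].
Qed.

Lemma eval_const (c : PV 0) m v : denotes c m -> eval pv_fun v (const c) = m.
Proof. by move=> <- /=; congr pv_fun; apply/ffunP => -[]. Qed.

(** A semantic form of the theorem of Krajicek, Pudlak and Takeuti on
witnessing in universal theories. The runs that refute a given finite set of
candidates generate a proper filter; in the ultraproduct along an ultrafilter
extending it, [Reply d] refutes the candidate [d], for all [d]
simultaneously. *)
Lemma unprovable_PrimeFactor (one two : PV 0) (le dvd : PV 2) :
  denotes one 1 -> denotes two 2 -> expresses le leq -> expresses dvd dvdn ->
  (forall L : seq play, exists e, [/\ run e, 2 <= e Start &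
     forall d, List.In d L -> refutes (e Start) (e d) (e (Reply d))]) ->
  ~ proves T_PV (PrimeFactor one two le dvd).
Proof.
move=> h1 h2 hle hdvd game.
pose good L := [set e | [/\ run e, 2 <= e Start &
  forall d, List.In d L -> refutes (e Start) (e d) (e (Reply d))]]%classic.
have FF : ProperFilter (filter_from setT good).
  apply: filter_from_proper; last by move=> L _; apply: game.
  apply: filter_from_filter; first by exists [::].
  move=> L L' _ _; exists (L ++ L') => // e [re x2 r].
  by split; split=> // d Ld; apply: r; apply: List.in_or_app; auto.
have [U [UU sFU]] := ultraFilterLemma FF.
have Ugood L : U (good L) by apply: sFU; exists L.
have Urun : U [set e | run e]%classic by apply: filterS (Ugood [::]) => e [].
move/(proves_T_PV_ultra UU Urun (fun=> Start)) => /= /(_ Start).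
set v := scons Start _; case=> [|d].
  apply/(@los U UU Urun v (atom one le (const two) (Var 0))) => //.
  apply: filterS (Ugood [::]) => e [re x2 _].
  by apply/(eval_atom _ _ _ h1 hle); rewrite (eval_const _ h2).
set v1 := scons d _ => -[].
move/(@los U UU Urun v1 (atom one le (Var 0) (Var 1))) => /(_ isT) Uyx.
move=> /(_ (Reply d)); set v2 := scons (Reply d) _.
move/(@los U UU Urun v2 (FImp (atom one le (Var 0) (Var 1))
        (FAnd (atom one le (const two) (Var 1))
        (FAnd (atom one dvd (Var 1) (Var 2))
              (FImp (atom one dvd (Var 0) (Var 1))
                    (FOr (FEq (Var 0) (const one))
                         (FEq (Var 0) (Var 1)))))))) => /(_ isT) Uz.
have [e [[/= le_yx Hz] [re x2 /(_ d (or_introl erefl))]]] :=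
  filter_ex (filterI (filterI Uyx Uz) (Ugood [:: d])).
move: le_yx => /(eval_atom _ _ _ h1 hle) /= le_yx.
rewrite /refutes le_yx /= => /andP[le_zy /negP[]].
move: Hz => [|]; first exact/(eval_atom _ _ _ h1 hle).
move=> /(eval_atom _ _ _ h1 hle); rewrite (eval_const _ h2) /= => -> [].
move=> /(eval_atom _ _ _ h1 hdvd) /= -> Hz; apply/implyP => zy.
have [|->|->] := Hz; first exact/(eval_atom _ _ _ h1 hdvd).
- by have /= -> := eval_const (fun n : nat => e (v2 n)) h1; rewrite eqxx.
- by rewrite eqxx orbT.
Qed.

(** * Joint circuit complexity of families of Boolean functions *)

Section Derives.
Variable X : Type.
Local Open Scope classical_set_scope.
Implicit Types (A B C : set (X -> bool)) (f g : X -> bool).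

(** Wires are identified with the Boolean functions that they carry, on an
arbitrary type [X] of instances. Circuits are then composed without renumbering
wires, and inputs need not be strings. *)
Inductive gate_fun A : (X -> bool) -> Prop :=
  | gate_fun_const b : gate_fun A (fun=> b)
  | gate_fun_not f : A f -> gate_fun A (fun x => ~~ f x)
  | gate_fun_and f g : A f -> A g -> gate_fun A (fun x => f x && g x)
  | gate_fun_or f g : A f -> A g -> gate_fun A (fun x => f x || g x).

Inductive derives : nat -> set (X -> bool) -> set (X -> bool) -> Prop :=
  | derives_sub s A B : B `<=` A -> derives s A B
  | derives_gate s A B g : gate_fun A g -> derives s (g |` A) B ->
    derives s.+1 A B.

Lemma gate_funS A B g : A `<=` B -> gate_fun A g -> gate_fun B g.
Proof.
move=> AB [b|f Af|f f' Af Af'|f f' Af Af']; first exact: gate_fun_const.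
- by apply: gate_fun_not; apply: AB.
- by apply: gate_fun_and; apply: AB.
- by apply: gate_fun_or; apply: AB.
Qed.

Lemma derivesW s s' A A' B B' : s <= s' -> A `<=` A' -> B' `<=` B ->
  derives s A B -> derives s' A' B'.
Proof.
move=> ss' AA' BB' d; elim: d s' A' ss' AA' BB' =>
  {s A B} [s A B BA|s A B g wg _ IH]
  s' A' ss' AA' BB'.
  by apply: derives_sub => f /BB'/BA/AA'.
case: s' ss' => // s' ss'; apply: (derives_gate (gate_funS AA' wg)).
by apply: IH => // f [->|/AA']; [left|right].
Qed.

Lemma derives_le s s' A B : s <= s' -> derives s A B -> derives s' A B.
Proof. by move=> ss'; apply: derivesW. Qed.

Lemma derives_trans s t A B C :
  derives s A B -> derives t (A `|` B) C -> derives (s + t) A C.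
Proof.
move=> d; elim: d C => {s A B} [s A B BA|s A B g wg _ IH] C.
  by apply: derivesW => //; [exact: leq_addl | move=> f [|/BA]].
rewrite addSn => dC; apply: (derives_gate wg); apply: IH; apply: derivesW dC =>
  //.
by move=> f [Af|Bf]; [left; right | right].
Qed.

Lemma derives_cut s t A B C :
  derives s A B -> derives t B C -> derives (s + t) A C.
Proof. by move=> dB dC; apply: (derives_trans dB); apply: derivesW dC. Qed.

Lemma derivesU s t A B C :
  derives s A B -> derives t A C -> derives (s + t) A (B `|` C).
Proof.
move=> dB dC.
suff: derives (t + 0) (A `|` B) (B `|` C) by rewrite addn0;
  apply: derives_trans.
apply: (@derives_trans _ _ _ C); first by apply: derivesW dC.
by apply: derives_sub => f [Bf|Cf]; [left; right | right].
Qed.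

Lemma derives1 s A g : gate_fun A g -> derives s.+1 A [set g].
Proof. by move=> w; apply: (derives_gate w); apply: derives_sub => f ->;
  left. Qed.

Lemma derives_bigcup (I : Type) (r : seq I) s A (B : I -> set (X -> bool)) :
  (forall i, List.In i r -> derives s A (B i)) ->
  derives (size r * s) A (\bigcup_(i in [set i | List.In i r]) B i).
Proof.
elim: r => [|i r IH] H.
  by rewrite mul0n; apply: derives_sub => f [].
rewrite mulSn; apply: (derivesW _ _ _ (derivesU (H i _) (IH _))) => //.
- by move=> f [j /= [<-|rj] Bf]; [left|right; exists j].
- by left.
- by move=> j rj; apply: H; right.
Qed.

Lemma In_mem (T : eqType) (x : T) (s : seq T) : List.In x s <-> x \in s.
Proof.
elim: s => //= y s ->; rewrite inE; split; first by case=> [->|->];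
  rewrite ?eqxx ?orbT.
by case/orP=> [/eqP->|]; auto.
Qed.

Lemma derives_bigcup_fin (I : finType) s A (B : I -> set (X -> bool)) :
  (forall i, derives s A (B i)) ->
  derives (#|I| * s) A (\bigcup_(i in setT) B i).
Proof.
move=> H; rewrite cardE.
apply: (derivesW _ _ _ (@derives_bigcup I (enum I) s A B (fun i _ => H i))) =>
  //.
by move=> f [i _ Bf]; exists i => //; apply/In_mem; rewrite mem_enum.
Qed.

Lemma derives_iter s (C : nat -> set (X -> bool)) T :
  (forall t, t < T -> derives s (C t) (C t.+1)) ->
  derives (T * s) (C 0) (\bigcup_(t in [set t | t <= T]) C t).
Proof.
elim: T => [|T IH] H.
  by apply: derives_sub => f [t /=]; rewrite leqn0 => /eqP->.
have {}IH := IH (fun t tT => H t (ltnW tT)).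
rewrite mulSn addnC; apply: (derives_trans IH).
have dS : derives s (C 0 `|` \bigcup_(t in [set t | t <= T]) C t) (C T.+1).
  by apply: derivesW (H T _) => // f Cf; right; exists T => /=.
rewrite -[s]addn0; apply: (derives_trans dS); apply: derives_sub => f [t /=].
rewrite leq_eqVlt ltnS => /orP[/eqP-> Cf|tT Cf]; first by right.
by left; right; exists t.
Qed.

(** A function with finitely many values is represented in one-hot form, by a
wire for each value. *)
Definition indicators (T : finType) (g : X -> T) : set (X -> bool) :=
  [set (fun x => g x == t) | t in setT].

Lemma derives_false A : derives 1 A [set fun=> false].
Proof. exact/derives1/gate_fun_const. Qed.

Lemma derives_ret (T : finType) (t : T) A : derives 2 A (indicators (fun=> t)).
Proof.
have d : derives 2 A ([set fun=> false] `|` [set fun=> true]).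
  by apply: (@derivesU 1 1); exact/derives1/gate_fun_const.
apply: derivesW d => // f [t' _ <-].
by case: (t == t'); [right|left].
Qed.

(** When the [G i] are the indicators of a function, this is a multiplexer. *)
Lemma derives_select (I : Type) (r : seq I) A (G F : I -> X -> bool) :
  (forall i, List.In i r -> A (G i) /\ A (F i)) ->
  derives (size r).*2.+1 A [set fun x => has (fun i => G i x && F i x) r].
Proof.
elim: r => [|i r IH] H; first exact: derives_false.
have {}IH : derives (size r).*2.+1 A
  [set fun x => has (fun i => G i x && F i x) r].
  by apply: IH => j rj; apply: H; right.
have [Gi Fi] := H i (or_introl erefl).
have -> : (size (i :: r)).*2.+1 = (size r).*2.+1 + 2 by rewrite /= doubleS
  addn2.
apply: (derives_trans IH).
apply: (@derives_gate _ _ _ (fun x => G i x && F i x)).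
  by apply: gate_fun_and; left.
apply: derives1; apply: gate_fun_or; first by left.
by right; right.
Qed.

(** In one-hot form, selecting one of several functions by the value of another
is a multiplexer for each value of the result. The cost depends on the sizes of
the two types only, and every computation with finite control reduces to this
lemma. *)
Lemma derives_bind (T T' : finType) (g : X -> T) (F : T -> X -> T') A :
  indicators g `<=` A -> (forall t, indicators (F t) `<=` A) ->
  derives (#|T'| * (#|T|.*2.+1)) A (indicators (fun x => F (g x) x)).
Proof.
move=> gA FA.
apply: (derivesW _ _ _ (derives_bigcup_fin (A := A)
  (B := fun t' => [set fun x => F (g x) x == t']) _)) => //.
  by move=> f [t' _ <-]; exists t'.
move=> t'; rewrite cardE.
suff -> : (fun x => F (g x) x == t') =
    (fun x => has (fun t => (g x == t) && (F t x == t')) (enum T)).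
  apply: (@derives_select _ _ _ (fun t x => g x == t)
    (fun t x => F t x == t')) => t _.
  by split; [apply: gA; exists t | apply: (FA t); exists t'].
apply: funext => x; apply/idP/hasP => [/eqP Ft|[t _ /andP[/eqP-> //]]].
by exists (g x); rewrite ?mem_enum // Ft !eqxx.
Qed.

Lemma derives_map (T T' : finType) (h : T -> T') (g : X -> T) A :
  indicators g `<=` A -> derives (#|T'| * (#|T|.*2.+1) + 2) A
    (indicators (fun x => h (g x))).
Proof.
move=> gA; rewrite addnC;
  apply: (@derives_trans _ _ _ ([set fun=> false] `|` [set fun=> true])).
  by apply: (@derivesU 1 1); exact/derives1/gate_fun_const.
apply: (@derives_bind _ _ g (fun t _ => h t)) => [f /gA|t f [t' _ <-]];
  first by left.
by right; case: (h t == t'); [right|left].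
Qed.

Lemma derives_all (I : Type) (r : seq I) A (G : I -> X -> bool) :
  (forall i, List.In i r -> A (G i)) ->
  derives (size r).+1 A [set fun x => all (fun i => G i x) r].
Proof.
elim: r => [|i r IH] H; first exact/derives1/gate_fun_const.
have {}IH : derives (size r).+1 A [set fun x => all (fun i => G i x) r].
  by apply: IH => j rj; apply: H; right.
have Gi := H i (or_introl erefl).
rewrite -addn1; apply: (derives_trans IH).
by apply: derives1; apply: gate_fun_and; [left|right].
Qed.

Lemma derives_has (I : Type) (r : seq I) A (G : I -> X -> bool) :
  (forall i, List.In i r -> A (G i)) ->
  derives (size r).+1 A [set fun x => has (fun i => G i x) r].
Proof.
elim: r => [|i r IH] H; first exact/derives1/gate_fun_const.
have {}IH : derives (size r).+1 A [set fun x => has (fun i => G i x) r].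
  by apply: IH => j rj; apply: H; right.
have Gi := H i (or_introl erefl).
rewrite -addn1; apply: (derives_trans IH).
by apply: derives1; apply: gate_fun_or; [left|right].
Qed.

Lemma derives_pack (I T : finType) (g : I -> X -> T) A :
  (forall i, indicators (g i) `<=` A) ->
  derives (#|{ffun I -> T}| * #|I|.+1) A
    (indicators (fun x => [ffun i => g i x])).
Proof.
move=> gA; apply: (derivesW _ _ _ (derives_bigcup_fin (A := A)
  (B := fun t : {ffun I -> T} => [set fun x => [ffun i => g i x] == t]) _)) =>
    //.
  by move=> f [t _ <-]; exists t.
move=> t; rewrite cardE.
suff -> : (fun x => [ffun i => g i x] == t) =
    (fun x => all (fun i => g i x == t i) (enum I)).
  by apply: (@derives_all _ _ _ (fun i x => g i x == t i)) => i _;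
    apply: (gA i); exists (t i).
apply: funext => x; apply/eqP/allP => [<- i _|H]; first by rewrite ffunE.
by apply/ffunP => i; rewrite ffunE; apply/eqP/H; rewrite mem_enum.
Qed.

Lemma derives_pair (T1 T2 : finType) (g1 : X -> T1) (g2 : X -> T2) A :
  indicators g1 `<=` A -> indicators g2 `<=` A ->
  derives (#|{: T1 * T2}| * 1) A (indicators (fun x => (g1 x, g2 x))).
Proof.
move=> g1A g2A; apply: (derivesW _ _ _ (derives_bigcup_fin (A := A)
  (B := fun t : T1 * T2 => [set fun x => (g1 x, g2 x) == t]) _)) => //.
  by move=> f [t _ <-]; exists t.
case=> t1 t2; rewrite
  (_ : (fun x => _) = (fun x => (g1 x == t1) && (g2 x == t2))).
  by apply: derives1; apply: gate_fun_and;
    [apply: g1A; exists t1 | apply: g2A; exists t2].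
by apply: funext => x; rewrite xpair_eqE.
Qed.

Lemma derives_bool f A : A f -> derives 1 A (indicators f).
Proof.
move=> Af; apply: (@derives_gate _ _ _ (fun x => ~~ f x));
  first exact: gate_fun_not.
apply: derives_sub => _ [[] _ <-]; [right|left].
- by rewrite (_ : (fun x => _) = f) //; apply: funext => x; rewrite eqb_id.
- by apply: funext => x; rewrite eqbF_neg.
Qed.

Lemma indicators_bool f : indicators f f.
Proof. by exists true => //; apply: funext => x; rewrite eqb_id. Qed.

Lemma indicators_eq (T : finType) (g : X -> T) t : indicators g
  (fun x => g x == t).
Proof. by exists t. Qed.

End Derives.

Arguments derives {X}.

(** * Circuits from derivations *)

Definition run_gates (gs : seq gate) (x : seq bool) : seq bool :=
  foldl (fun vs g => rcons vs (gate_val vs g)) x gs.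

Lemma size_run_gates gs x : size (run_gates gs x) = size x + size gs.
Proof.
by elim: gs x => [|g gs IH] x /=; rewrite ?addn0 // IH size_rcons addSnnS.
Qed.

Lemma run_gates_rcons gs g x :
  run_gates (rcons gs g) x = rcons (run_gates gs x)
    (gate_val (run_gates gs x) g).
Proof. by rewrite /run_gates -cats1 foldl_cat. Qed.

Lemma gates_wf_rcons w gs g :
  gates_wf w (rcons gs g) = gates_wf w gs && gate_wf (w + size gs) g.
Proof.
by elim: gs w => [|h gs IH] w /=; rewrite ?addn0 ?andbT // IH addSnnS andbA.
Qed.

Section Wiring.
Variables (X : Type) (k : nat) (inp : X -> k.-tuple bool).

Definition computed (gs : seq gate) : set (X -> bool) :=
  [set f | exists2 i, i < k + size gs &
    forall x, nth false (run_gates gs (inp x)) i = f x]%classic.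

Lemma derives_computed s A B gs : derives s A B -> gates_wf k gs ->
  (A `<=` computed gs)%classic ->
  exists gs', [/\ gates_wf k gs', size gs' <= size gs + s &
                 (B `<=` computed gs')%classic].
Proof.
move=> d; elim: d gs => {s A B} [s A B BA|s A B g wg _ IH] gs wf Ags.
  by exists gs; split=> //; [exact: leq_addr | move=> f /BA/Ags].
have [h [wfh hE]] : exists h, gate_wf (k + size gs) h /\
    forall x, gate_val (run_gates gs (inp x)) h = g x.
  case: wg => [b|f /Ags[i ik fE]|f1 f2 /Ags[i ik fE] /Ags[j jk gE]
              |f1 f2 /Ags[i ik fE] /Ags[j jk gE]].
  - by exists (GConst b).
  - by exists (GNot i); split=> //= x; rewrite fE.
  - by exists (GAnd i j); split=> [|x] /=; rewrite ?ik ?fE ?gE.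
  - by exists (GOr i j); split=> [|x] /=; rewrite ?ik ?fE ?gE.
have [||gs' [wf' sz' B']] := IH (rcons gs h).
- by rewrite gates_wf_rcons wf.
- move=> f [->|/Ags[i ik fE]].
    exists (k + size gs); first by rewrite size_rcons addnS.
    by move=> x; rewrite run_gates_rcons nth_rcons size_run_gates size_tuple
      ltnn eqxx.
  exists i; first by rewrite size_rcons addnS ltnS ltnW.
  by move=> x; rewrite run_gates_rcons nth_rcons size_run_gates size_tuple ik.
- by exists gs'; split=> //; move: sz'; rewrite size_rcons addSnnS.
Qed.

Lemma derives_circuit s (outs : seq (X -> bool)) :
  derives s [set (fun x => tnth (inp x) i) | i in [set: 'I_k]]
            [set f | List.In f outs]%classic ->
  exists C : circuit k, circuit_size C <= k + s + size outs /\
    forall x, circuit_run C (inp x) = [seq f x | f <- outs].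
Proof.
move=> /derives_computed -/(_ [::] isT)[|gs [wf sz gsB]].
  move=> _ [i _ <-]; exists i; first by rewrite addn0.
  by move=> x /=; rewrite (tnth_nth false).
have [os [osP szo osE]] : exists os, [/\ all (fun i => i < k + size gs) os,
    size os = size outs &
    forall x, [seq nth false (run_gates gs (inp x)) i | i <- os]
      = [seq f x | f <- outs]].
  elim: outs gsB => [|f outs IH] gsB; first by exists [::].
  have [|os [osP szo osE]] := IH; first by move=> h ?; apply: gsB; right.
  have [i ik iE] := gsB f (or_introl erefl).
  by exists (i :: os); split=> [||x] /=; rewrite ?ik ?szo ?iE ?osE.
exists (Circuit wf osP); split; last exact: osE.
by rewrite /circuit_size /= szo leq_add2r leq_add2l.
Qed.

End Wiring.

(** * Binary digits *)

Lemma bit0 n : bit n 0 = odd n.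
Proof. by rewrite /bit expn0 divn1. Qed.

Lemma bitS n i : bit n i.+1 = bit n./2 i.
Proof. by rewrite /bit expnS divnMA divn2. Qed.

Lemma bit_zero i : bit 0 i = false.
Proof. by rewrite /bit div0n. Qed.

Lemma bit_small v i : v < 2 ^ i -> bit v i = false.
Proof. by move=> vi; rewrite /bit divn_small. Qed.

Lemma bits0_lt v j : (forall i, j <= i -> bit v i = false) -> v < 2 ^ j.
Proof.
elim: j v => [|j IH] v H.
  elim/ltn_ind: v H => -[//|v] IH H.
  have lt_half : (v.+1)./2 < v.+1 by lia.
  have := IH _ lt_half; rewrite expn0 => {}IH.
  have: (v.+1)./2 < 1 by apply: IH => i _; rewrite -bitS H.
  by have := H 0 isT; rewrite bit0; lia.
suff: v./2 < 2 ^ j by rewrite expnS; lia.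
by apply: IH => i ji; rewrite -bitS H.
Qed.

Lemma bit_inj u v : (forall i, bit u i = bit v i) -> u = v.
Proof.
elim/ltn_ind: u v => u IH v H.
have [u0|u_gt0] := posnP u.
  have: v < 2 ^ 0 by apply: bits0_lt => i _; rewrite -H u0 bit_zero.
  by rewrite expn0; lia.
have /IH /(_ v./2) E : u./2 < u by lia.
have {}E : u./2 = v./2 by apply: E => i; rewrite -!bitS.
have := H 0; rewrite !bit0; lia.
Qed.

Lemma bits_val_cons b s : bits_val (b :: s) = b + (bits_val s).*2.
Proof. by []. Qed.

Lemma bit_bits_val s i : bit (bits_val s) i = nth false s i.
Proof.
elim: s i => [|b s IH] i; first by rewrite nth_nil bit_zero.
rewrite bits_val_cons; case: i => [|i] /=;
  first by rewrite bit0 oddD odd_double oddb addbF.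
by rewrite bitS -IH; congr bit; case: b; lia.
Qed.

Lemma bits_val_lt s : bits_val s < 2 ^ size s.
Proof.
apply: bits0_lt => i si; by rewrite bit_bits_val nth_default.
Qed.

Lemma lt_exp2_bits v W j : v < 2 ^ W ->
  (v < 2 ^ j) = ~~ has (bit v) (iota j (W - j)).
Proof.
move=> vW; apply/idP/hasPn => [vj i|H].
  rewrite mem_iota => /andP[ji _]; rewrite bit_small //.
  by apply: leq_trans vj _; rewrite leq_exp2l.
apply: bits0_lt => i ji; have [iW|Wi] := ltnP i W.
  by apply/negbTE/H; rewrite mem_iota ji; lia.
by apply/bit_small/(leq_trans vW); rewrite leq_exp2l.
Qed.

Lemma binlen_le v j : (binlen v <= j) = (v < 2 ^ j).
Proof.
apply/idP/idP => [H|]; last exact: up_log_min.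
by apply: leq_trans (up_logP v.+1 (isT : 1 < 2)) _; rewrite leq_exp2l.
Qed.

Lemma size_bits v : size (bits v) = binlen v.
Proof. exact: size_mkseq. Qed.

Section BitFunctions.
Variable X : Type.
Local Open Scope classical_set_scope.

(** All but finitely many of these functions vanish, so no bound on [v] has to
be part of the notion. *)
Definition digits (v : X -> nat) : set (X -> bool) :=
  [set (fun x => bit (v x) j) | j in setT].

Lemma derives_digits s A W (v : X -> nat) : (forall x, v x < 2 ^ W) ->
  (forall j, j < W -> derives s A [set fun x => bit (v x) j]) ->
  derives (W * s + 1) A (digits v).
Proof.
move=> vW H.
apply: (derivesW _ _ _ (derivesU (derives_bigcup (r := iota 0 W) (s := s)
  (B := fun j => [set fun x => bit (v x) j]) _) (derives_false A))) => //.
- by rewrite size_iota.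
- move=> f [j _ <-]; have [jW|Wj] := ltnP j W.
    by left; exists j => //; apply/In_mem; rewrite mem_iota.
  right; apply: funext => x; apply: bit_small; apply: leq_trans (vW x) _.
  by rewrite leq_exp2l.
- by move=> j /In_mem; rewrite mem_iota; apply: H.
Qed.

Lemma derives_lt_exp2 W v j : (forall x, v x < 2 ^ W) ->
  derives W.+2 (digits v) [set fun x => v x < 2 ^ j].
Proof.
move=> vW; rewrite -[W.+2]addn1.
apply: (@derives_cut _ _ _ _ [set fun x => has (bit (v x)) (iota j (W - j))]).
  apply: (derivesW _ _ _ (derives_has (r := iota j (W - j))
    (A := digits v) (G := fun i x => bit (v x) i) _)) => //.
  - by rewrite size_iota ltnS leq_subr.
  - by move=> i _; exists i.
suff -> : (fun x => v x < 2 ^ j)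
  = (fun x => ~~ has (bit (v x)) (iota j (W - j))).
  exact/derives1/gate_fun_not.
by apply: funext => x; apply: lt_exp2_bits.
Qed.

(** The bound on [v] makes [inord] exact. For [t > 0], a number has length [t]
if it is below [2 ^ t] but not below [2 ^ t.-1]. *)
Lemma derives_binlen W v : (forall x, v x < 2 ^ W) ->
  derives (W.+1 * (W.+2 + W.+2 + 2) ) (digits v)
    (indicators (fun x => inord (binlen (v x)) : 'I_W.+1)).
Proof.
move=> vW.
apply: (derivesW _ _ _
  (derives_bigcup_fin (A := digits v) (s := W.+2 + W.+2 + 2)
  (B := fun t : 'I_W.+1 =>
    [set fun x => (inord (binlen (v x)) : 'I_W.+1) == t]) _)) => //.
- by rewrite card_ord.
- by move=> f [t _ <-]; exists t.
move=> t; apply: (@derives_cut _ _ _ _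
   ([set fun x => v x < 2 ^ t] `|` [set fun x => v x < 2 ^ t.-1])).
  by apply: derivesU; apply: derives_lt_exp2.
have E x : (inord (binlen (v x)) == t :> 'I_W.+1) =
    (v x < 2 ^ t) && (if t == 0 :> nat then true else ~~ (v x < 2 ^ t.-1)).
  have bW : binlen (v x) <= W by rewrite binlen_le.
  rewrite -val_eqE /= inordK // -!binlen_le.
  by case: (nat_of_ord t) => [|j] /=; lia.
case t0: (t == 0 :> nat).
  apply: derives_sub => _ ->; left; apply: funext => x.
  by rewrite E t0 andbT.
apply: (@derives_trans _ 1 1 _ [set fun x => ~~ (v x < 2 ^ t.-1)]).
  by apply: derives1; apply: gate_fun_not; right.
suff -> : (fun x => (inord (binlen (v x)) : 'I_W.+1) == t) =
    (fun x => (v x < 2 ^ t) && ~~ (v x < 2 ^ t.-1)).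
  by apply: derives1; apply: gate_fun_and; [left; left | right].
by apply: funext => x; rewrite E t0.
Qed.

End BitFunctions.

(** * Polynomial bounds *)

Definition poly_bounded (f : nat -> nat) : Prop :=
  exists c, forall n, f n <= n ^ c + c.

(** For [n >= 2] an additive constant is absorbed by a larger exponent, and the
values at 0 and 1 are absorbed by the constant. In this form closure under sums
and products is immediate. *)
Lemma poly_boundedP f : poly_bounded f <-> exists c, forall n, 2 <= n -> f n
  <= n ^ c.
Proof.
split=> [[c fc]|[c fc]].
  exists (c + c) => n n2; apply: leq_trans (fc n) _.
  have cn : c < n ^ c by apply: ltn_expl.
  rewrite expnD; have : 1 < n ^ c \/ c = 0 by case: (c) cn => [|c'];
    [right | left; lia].
  case=> [|->]; last by rewrite expn0.
  nia.
exists (c + f 0 + f 1) => -[|[|n]]; first by lia.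
  by rewrite exp1n; lia.
apply: leq_trans (fc n.+2 isT) _; apply: leq_trans (leq_addr _ _).
by rewrite leq_exp2l // -addnA leq_addr.
Qed.

Lemma poly_bounded_le f g : (forall n, f n <= g n) -> poly_bounded g ->
  poly_bounded f.
Proof. by move=> fg [c gc]; exists c => n; apply: leq_trans (fg n) (gc n). Qed.

Lemma poly_bounded_const m : poly_bounded (fun=> m).
Proof. by exists m => n; apply: leq_addl. Qed.

Lemma poly_bounded_id : poly_bounded id.
Proof. by exists 1 => n; rewrite expn1 leq_addr. Qed.

Lemma poly_boundedD f g :
  poly_bounded f -> poly_bounded g -> poly_bounded (fun n => f n + g n).
Proof.
move=> /poly_boundedP[a fa] /poly_boundedP[b gb]; apply/poly_boundedP.
exists (a + b).+1 => n n2; have [{}fa {}gb] := (fa n n2, gb n n2).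
rewrite expnS expnD; have [a0 b0] : 0 < n ^ a /\
  0 < n ^ b by rewrite !expn_gt0; lia.
apply: leq_trans (leq_mul n2 (leqnn _)); nia.
Qed.

Lemma poly_boundedM f g :
  poly_bounded f -> poly_bounded g -> poly_bounded (fun n => f n * g n).
Proof.
move=> /poly_boundedP[a fa] /poly_boundedP[b gb]; apply/poly_boundedP.
by exists (a + b) => n n2; rewrite expnD leq_mul ?fa ?gb.
Qed.

Lemma poly_boundedX f c : poly_bounded f -> poly_bounded (fun n => f n ^ c).
Proof.
move=> pf; elim: c => [|c IH]; first exact: poly_bounded_const.
apply: poly_bounded_le (poly_boundedM pf IH) => n; by rewrite expnS.
Qed.

Lemma poly_bounded_sum k f :
  (forall i : 'I_k, poly_bounded (f i)) ->
    poly_bounded (fun n => \sum_(i < k) f i n).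
Proof.
elim: k f => [|k IH] f pf.
  by apply: poly_bounded_le (poly_bounded_const 0) => n; rewrite big_ord0.
apply: poly_bounded_le
  (poly_boundedD (IH _ (fun i => pf (widen_ord (leqnSn k) i)))
  (pf ord_max)) => n.
by rewrite big_ord_recr.
Qed.

Lemma poly_boundedS h : poly_bounded h -> poly_bounded (fun W => (h W).+1).
Proof.
move=> ph; apply: poly_bounded_le (poly_boundedD ph (poly_bounded_const 1)) =>
  W.
by rewrite addn1.
Qed.

Lemma poly_bounded_double h : poly_bounded h ->
  poly_bounded (fun n => (h n).*2).
Proof.
move=> ph; apply: poly_bounded_le (poly_boundedM ph (poly_bounded_const 2)) =>
  n.
by rewrite muln2.
Qed.

Lemma poly_bounded_comp f g : poly_bounded f -> poly_bounded g ->
  poly_bounded (f \o g).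
Proof.
case=> c fc pg; apply: (@poly_bounded_le _ (fun n => g n ^ c + c)) => [n|];
  first exact: fc.
by apply: poly_boundedD; [apply: poly_boundedX | apply: poly_bounded_const].
Qed.

Ltac poly_bound := repeat first [assumption | apply: poly_boundedX
  | apply: poly_boundedD | apply: poly_boundedM | apply: poly_bounded_const
  | exact: poly_bounded_id | apply: poly_bounded_double | apply: poly_boundedS].

(** * Circuits for the functions of PV *)

Section TuringMachine.
Variables (k : nat) (M : tm k).
Local Open Scope classical_set_scope.

Notation tapes := 'I_(k + (tm_work M).+1).
Notation scanned :=
  ('I_(tm_states M).+1 * {ffun tapes -> symbol (tm_extra M)})%type.

Section Wires.
Variables (P : nat) (X : Type) (c : X -> config M).

(** Exact only if the head is at a cell up to [P]. *)
Definition head_pos (i : tapes) (x : X) : 'I_P.+1 := inord ((c x).2 i).2.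
Definition cell_symbol (i : tapes) (j : 'I_P.+1) (x : X) : symbol
  (tm_extra M) :=
  nth None ((c x).2 i).1 j.
Definition scan (x : X) : scanned :=
  ((c x).1, [ffun i => tape_read ((c x).2 i)]).

Definition config_wires : set (X -> bool) :=
  indicators (fun x => (c x).1)
    `|` (\bigcup_(i in setT) indicators (head_pos i))
  `|` \bigcup_(ij in setT) indicators (cell_symbol ij.1 ij.2).

Lemma config_wires_state : indicators (fun x => (c x).1) `<=` config_wires.
Proof. by move=> f ?; left; left. Qed.

Lemma config_wires_head i : indicators (head_pos i) `<=` config_wires.
Proof. by move=> f ?; left; right; exists i. Qed.

Lemma config_wires_cell i j : indicators (cell_symbol i j) `<=` config_wires.
Proof. by move=> f ?; right; exists (i, j). Qed.

End Wires.

(** The scanned symbols are selected by the head positions. In a step, these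
are the only values that depend on more than boundedly many cells. *)
Lemma derives_scan : exists K, forall P X (c : X -> config M),
  (forall x i, ((c x).2 i).2 < P) -> derives (K * P.+1) (config_wires P c)
    (indicators (scan c)).
Proof.
pose K1 := #|tapes| * (#|{: symbol (tm_extra M)}| * 3).
pose K2 := #|{ffun tapes -> symbol (tm_extra M)}| * #|tapes|.+1.
pose K3 := #|{: scanned}| * 1.
exists (K1 + K2 + K3) => P X c cP.
have cP1 x i : ((c x).2 i).2 < P.+1 by rewrite ltnS ltnW.
have d1 : derives (K1 * P.+1) (config_wires P c)
    (\bigcup_(i in setT) indicators (fun x => tape_read ((c x).2 i))).
  rewrite -mulnA; apply: derives_bigcup_fin => i.
  apply: (derivesW _ _ _ (@derives_bind _ _ _ (head_pos P c i)
    (fun j => cell_symbol c i j) (config_wires P c) _ _)) => //.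
  - by rewrite card_ord -mulnA leq_mul2l; lia.
  - move=> f [s _ <-]; exists s => //; apply: funext => x.
    by rewrite /cell_symbol /head_pos inordK // cP1.
  - exact: config_wires_head.
  - by move=> j; apply: config_wires_cell.
rewrite mulnDl mulnDl -addnA; apply: (derives_trans d1).
have d2 : derives K2
  (\bigcup_(i in setT) indicators (fun x => tape_read ((c x).2 i)))
   (indicators (fun x => [ffun i => tape_read ((c x).2 i)])).
  by apply: derives_pack => i f Hf; exists i.
apply: (@derives_trans _ _ _ _
  (indicators (fun x => [ffun i => tape_read ((c x).2 i)]))).
  by apply: (derivesW (leq_pmulr _ _) _ _ d2).
set A := _ `|` _; apply: (@derivesW _ K3 _ A A (indicators (scan c))) => //.
  exact: leq_pmulr.
apply: (@derives_pair _ _ _ (fun x => (c x).1)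
  (fun x => [ffun i => tape_read ((c x).2 i)])) => f Hf; last by right.
by left; left; apply: config_wires_state.
Qed.

(** The new content of a cell is determined by its old content, by whether the
head is there, and by the state and the scanned symbols. *)
Lemma derives_tm_step : exists K, forall P X (c : X -> config M),
  (forall x i, ((c x).2 i).2 < P) ->
  derives (K * P.+1 ^ 2) (config_wires P c)
    (config_wires P (fun x => tm_step (c x))).
Proof.
have [K0 scanK] := derives_scan.
pose Kq := #|'I_(tm_states M).+1| * #|{: scanned}|.*2.+1 + 2.
pose Kh := #|tapes| * (#|{: scanned}| * 5 + #|{: scanned}|.*2.+1).
pose T3 := (scanned * (bool * symbol (tm_extra M)))%type.
pose Kc := #|tapes| * (1 + #|{: bool * symbol (tm_extra M)}| + #|{: T3}| +
             (#|{: symbol (tm_extra M)}| * #|{: T3}|.*2.+1 + 2)).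
exists (K0 + Kq + Kh + Kc) => P X c cP.
have cP1 x i : ((c x).2 i).2 < P.+1 by rewrite ltnS ltnW.
pose A := config_wires P c `|` indicators (scan c).
have scanA : indicators (scan c) `<=` A by move=> f; right.
have dq : derives Kq A (indicators (fun x => (tm_step (c x)).1)).
  pose h (s : scanned) := if tm_delta M s is Some (q, _) then q else s.1.
  suff -> : (fun x => (tm_step (c x)).1) = (fun x => h (scan c x)).
    exact: derives_map.
  by apply: funext => x; rewrite /h /tm_step -/(scan c x);
    case: (tm_delta M _) => [[]|].
have dh : derives (Kh * P.+1 ^ 2) A
    (\bigcup_(i in setT) indicators (head_pos P (fun x => tm_step (c x)) i)).
  rewrite -mulnA; apply: derives_bigcup_fin => i.
  pose h (s : scanned) (p : 'I_P.+1) : 'I_P.+1 :=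
    if tm_delta M s is Some (_, act)
    then inord match (act i).2 with MLeft => p.-1 | MStay => p | MRight =>
      p.+1 end
    else p.
  rewrite (_ : head_pos P _ i = (fun x => h (scan c x) (head_pos P c i x)));
    last first.
    apply: funext => x; rewrite /h /head_pos /tm_step -/(scan c x).
    case: (tm_delta M _) => [[q act]|] //=; rewrite ffunE /tape_act /=.
    by rewrite inordK ?cP1.
  rewrite mulnDl; apply: (@derives_trans _ _ _ _
      (\bigcup_(s in setT) indicators (fun x => h s (head_pos P c i x)))).
    rewrite -mulnA; apply: derives_bigcup_fin => s.
    apply: (derives_le _ (derives_map (h s) (g := head_pos P c i) (A := A) _)).
      by rewrite card_ord -mulnn; nia.
    by move=> f Hf; left; apply: config_wires_head Hf.
  apply: (derives_le _ (@derives_bind _ _ _ (scan c)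
    (fun s x => h s (head_pos P c i x)) (A `|` _) _ _)).
  - by rewrite card_ord mulnC leq_mul2l -mulnn leq_pmulr ?orbT.
  - by move=> f Hf; left; right.
  - by move=> s f Hf; right; exists s.
have dc : derives (Kc * P.+1) A
    (\bigcup_(ij in setT) indicators
      (cell_symbol (P := P) (fun x => tm_step (c x)) ij.1 ij.2)).
  have -> : Kc * P.+1 = #|{: tapes * 'I_P.+1}|
    * (1 + #|{: bool * symbol (tm_extra M)}|
      + #|{: T3}| + (#|{: symbol (tm_extra M)}| * #|{: T3}|.*2.+1 + 2)).
    by rewrite card_prod [#|'I_P.+1|]card_ord mulnAC.
  apply: derives_bigcup_fin => -[i j] /=.
  pose b x := head_pos P c i x == j.
  pose h (s : T3) : symbol (tm_extra M) :=
    if tm_delta M s.1 is Some (_, act)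
    then if s.2.1 then (act i).1 else s.2.2 else s.2.2.
  rewrite (_ : cell_symbol _ i j
    = (fun x => h (scan c x, (b x, cell_symbol c i j x)))); last first.
    apply: funext => x; rewrite /h /b /cell_symbol /head_pos /tm_step
      -/(scan c x).
    case: (tm_delta M _) => [[q act]|] //=;
      rewrite ffunE /tape_act /= nth_set_nth /=.
    by rewrite -val_eqE /= inordK ?cP1 // eq_sym.
  apply: (@derives_trans _ _ _ _
    (indicators (fun x => (scan c x, (b x, cell_symbol c i j x))))); last first.
    by apply: derives_map => f; right.
  rewrite -[#|{: T3}|]muln1;
    apply: (@derives_trans _ _ _ _
      (indicators (fun x => (b x, cell_symbol c i j x)))); last first.
    by apply: derives_pair => f Hf; [left; right|right].
  rewrite -[#|{: bool * _}|]muln1;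
    apply: (@derives_trans _ _ _ _ (indicators b)).
    by apply: derives_bool; left; apply: config_wires_head (i) _ _; exists j.
  apply: derives_pair => f Hf; first by right.
  by left; left; apply: config_wires_cell Hf.
apply: (derivesW _ _ _
  (derives_trans (scanK P X c cP) (derivesU (derivesU dq dh) dc))) => //.
have add_costs (a b d e m p : nat) : 0 < m -> p <= m ->
    a * p + (b + d * m + e * p) <= (a + b + d + e) * m by nia.
by apply: add_costs; rewrite -mulnn; nia.
Qed.

End TuringMachine.

Section Runs.
Variables (k : nat) (M : tm k).
Local Open Scope classical_set_scope.

Lemma iter_tm_step_head (u : {ffun 'I_k -> nat}) t i :
  ((iter t (@tm_step k M) (tm_init M u)).2 i).2 <= t.
Proof.
elim: t i => [|t IH] i /=; first by rewrite ffunE; case: split.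
move: (iter t _ _) IH => c IH; rewrite /tm_step.
case: (tm_delta M _) => [[q act]|]; last by apply: leq_trans (IH i) _; lia.
rewrite ffunE /tape_act /=; have := IH i; case: (act i).2; lia.
Qed.

Lemma iter_tm_step_size (u : {ffun 'I_k -> nat}) W t i :
  (forall j, u j < 2 ^ W) ->
  size ((iter t (@tm_step k M) (tm_init M u)).2 i).1 <= W + t.
Proof.
move=> uW; elim: t i => [|t IH] i /=.
  rewrite ffunE addn0; case: split => j //=.
  by rewrite size_map size_bits binlen_le.
move: (iter t _ _) IH (iter_tm_step_head u t) => c IH hc; rewrite /tm_step.
case: (tm_delta M _) => [[q act]|]; last by apply: leq_trans (IH i) _; lia.
by rewrite ffunE /tape_act size_set_nth; have := IH i; have := hc i; lia.
Qed.

(** Cell [j] of an input tape is blank iff the input is below [2 ^ j]. *)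
Lemma derives_init : exists K, forall P W (X : Type) (u : 'I_k -> X -> nat),
  (forall i x, u i x < 2 ^ W) ->
  derives (K * P.+1 * W.+2) (\bigcup_(i in setT) digits (u i))
     (config_wires P (fun x => tm_init M [ffun i => u i x])).
Proof.
pose nt := #|'I_(k + (tm_work M).+1)|; pose S := symbol (tm_extra M).
pose Kc := 7 + #|{: bool * bool}| + #|{: S}| * #|{: bool * bool}|.*2.+1.
exists (2 + nt * 2 + nt * Kc) => P W X u uW.
set A := \bigcup_(i in setT) _.
have ds : derives 2 A (indicators (fun x => (tm_init M [ffun i => u i x]).1)).
  exact: derives_ret.
have dh : derives (nt * 2) A
    (\bigcup_(i in setT) indicators
      (head_pos P (fun x => tm_init M [ffun i => u i x]) i)).
  apply: derives_bigcup_fin => i.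
  suff -> : head_pos P (fun x => tm_init M [ffun i => u i x]) i
    = (fun=> inord 0).
    exact: derives_ret.
  by apply: funext => x; rewrite /head_pos ffunE; case: split.
have dc : derives (nt * P.+1 * (Kc * W.+2)) A (\bigcup_(ij in setT)
    indicators (cell_symbol (P := P) (fun x => tm_init M [ffun i => u i x])
      ij.1 ij.2)).
  have -> : nt * P.+1 = #|{: 'I_(k + (tm_work M).+1) * 'I_P.+1}|.
    by rewrite card_prod [#|'I_P.+1|]card_ord.
  apply: derives_bigcup_fin => -[i j] /=.
  rewrite /cell_symbol; case E: (split i) => [l|l]; last first.
    suff -> : (fun x => nth None ((tm_init M [ffun i => u i x]).2 i).1 j)
      = (fun=> None).
      by apply: derives_le (derives_ret _ _); rewrite /Kc; lia.
    by apply: funext => x; rewrite ffunE E nth_nil.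
  pose h (s : bool * bool) : S := if s.1 then None else Some (inl s.2).
  suff -> : (fun x => nth None ((tm_init M [ffun i => u i x]).2 i).1 j) =
      (fun x => h (u l x < 2 ^ j, bit (u l x) j)).
    pose f1 x := u l x < 2 ^ j; pose f2 x := bit (u l x) j.
    have Al f : digits (u l) f -> A f by exists l.
    have d1 : derives (W.+2 + 1) A (indicators f1).
      apply: (@derives_cut _ _ _ _ [set f1]); last exact: derives_bool.
      exact: derivesW (leqnn _) Al (fun _ => id) (derives_lt_exp2 j (uW l)).
    have d2 : derives 1 A (indicators f2) by apply/derives_bool/Al;
      exists (nat_of_ord j).
    have d3 : derives (#|{: bool * bool}| * 1) (indicators f1 `|` indicators f2)
        (indicators (fun x => (f1 x, f2 x))).
      by apply: derives_pair => f ?; [left|right].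
    apply: derives_le (derives_cut (derives_cut (derivesU d1 d2) d3)
      (derives_map h (fun _ => id))).
    rewrite /Kc; set b := #|_|; set s := #|_|; nia.
  apply: funext => x; rewrite ffunE E /= /h /= !ffunE.
  rewrite -binlen_le leqNgt; case: ltnP => [lt|ge] /=.
    by rewrite (nth_map false) ?size_bits // nth_mkseq.
  by rewrite nth_default // size_map size_bits.
apply: derives_le (derivesU (derivesU ds dh) dc).
have add_costs (a b e p w : nat) : 0 < p -> 0 < w ->
    a + b + e * p * (Kc * w) <= (a + b + e * Kc) * p * w.
  move=> p0 w0; rewrite mulnACA -(mulnA _ p w) mulnDl leq_add2r leq_pmulr //
    muln_gt0.
  exact/andP.
by apply: add_costs.
Qed.

End Runs.

Definition is_bit (a : nat) (s : symbol a) : bool :=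
  if s is Some (inl _) then true else false.

Lemma nth_leading_bits a (s : seq (symbol a)) j :
  nth false (leading_bits s) j =
  all (fun i => is_bit (nth None s i)) (iota 0 j.+1) &&
    (nth None s j == Some (inl true)).
Proof.
elim: s j => [|x s IH] j; first by rewrite !nth_nil.
rewrite /= (iotaDl 1) all_map.
case: x => [[b|x]|] //=; last by rewrite nth_nil.
  by case: j => [|j] /=; [case: b | rewrite IH].
by rewrite nth_nil.
Qed.

Lemma size_leading_bits a (s : seq (symbol a)) : size (leading_bits s)
  <= size s.
Proof. by elim: s => // -[[b|x]|] s IH. Qed.

Lemma leq_expl m n e : m <= n -> m ^ e <= n ^ e.
Proof. by case: e => // e mn; rewrite leq_exp2r. Qed.

Section PVFunction.
Local Open Scope classical_set_scope.

(** The running time depends on the lengths of the inputs, which vary with the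
instance. So the run is unrolled to the maximal time for the given width, and
the output tape at the time prescribed by the clock is selected. *)
Lemma pv_fun_derives k (f : PV k) : exists Q, poly_bounded Q /\
  forall W (X : Type) (u : 'I_k -> X -> nat), (forall i x, u i x < 2 ^ W) ->
    (forall x, pv_fun f [ffun i => u i x] < 2 ^ Q W) /\
    derives (Q W) (\bigcup_(i in setT) digits (u i))
                  (digits (fun x => pv_fun f [ffun i => u i x])).
Proof.
case: f => M c.
have [K0 initK] := derives_init M; have [K1 stepK] := derives_tm_step M.
pose S := symbol (tm_extra M); pose nS := #|{: S}|.
(* [Tm] bounds the time and [P] the space. The summands of the cost are for the
   initial configuration, the run, the input lengths, the vector of these, the
   output tape when the clock stops, the test which of its cells hold bits, and
   the output. *)
pose Tm W := (k * W) ^ c + c.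
pose P W := W + Tm W + 1.
pose a0 W := K0 * (P W).+1 * W.+2.
pose a1 W := Tm W * (K1 * (P W).+1 ^ 2).
pose a2 W := k * (W.+1 * (W.+2 + W.+2 + 2)).
pose a3 W := W.+1 ^ k * k.+1.
pose a4 W := (P W).+1 * (nS * (2 * W.+1 ^ k + 1)).
pose a5 W := (P W).+1 * (2 * nS.*2.+1 + 2).
pose a6 W := P W * ((P W).+1.+1 + 1) + 1.
exists (fun W => P W + (a0 W + a1 W + (a2 W + a3 W) + a4 W + a5 W + a6 W)).
have pT : poly_bounded Tm by rewrite /Tm; poly_bound.
have pP : poly_bounded P by rewrite /P; poly_bound.
split; first by rewrite /a0 /a1 /a2 /a3 /a4 /a5 /a6; poly_bound.
move=> W X u uW; set A := \bigcup_(i in setT) _.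
pose cfg t x := iter t (@tm_step k M) (tm_init M [ffun i => u i x]).
pose bl i x : 'I_W.+1 := inord (binlen (u i x)).
pose g x := [ffun i => bl i x].
pose time (v : {ffun 'I_k -> 'I_W.+1}) := (\sum_(i < k) v i) ^ c + c.
have timeT v : time v <= Tm W.
  rewrite /time /Tm leq_add2r; apply: leq_expl.
  rewrite -[k in leqRHS]card_ord -sum_nat_const; apply: leq_sum => i _.
  by rewrite -ltnS.
have cfgP t x i : t <= Tm W -> ((cfg t x).2 i).2 < P W.
  by move=> tT; have := iter_tm_step_head (M := M) [ffun i => u i x] t i;
     rewrite /P -/(cfg t x); lia.
have d0 : derives (a0 W) A (config_wires (P W) (cfg 0)) by apply: initK.
have d1 : derives (a1 W) (config_wires (P W) (cfg 0))
    (\bigcup_(t in [set t | t <= Tm W]) config_wires (P W) (cfg t)).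
  apply: (@derives_iter _ _ (fun t => config_wires (P W) (cfg t))) => t tT.
  by apply: stepK => x i; apply: cfgP; apply: ltnW.
have d2 : derives (a2 W) A (\bigcup_(i in setT) indicators (bl i)).
  rewrite /a2 -[k in X in derives X](card_ord k); apply: derives_bigcup_fin =>
    i.
  by apply: derivesW (derives_binlen (uW i)) => // h Bh; exists i.
have d3 : derives (a3 W) (\bigcup_(i in setT) indicators (bl i)) (indicators g).
  apply: derives_le (derives_pack (g := bl) _).
    by rewrite card_ffun !card_ord.
  by move=> i h Bh; exists i.
pose o : 'I_(k + (tm_work M).+1) := rshift k ord0.
pose fcell j x : S := cell_symbol (P := P W) (cfg (time (g x))) o j x.
have d4 : derives (a4 W)
    (\bigcup_(t in [set t | t <= Tm W]) config_wires (P W) (cfg t)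
      `|` indicators g)
    (\bigcup_(j in setT) indicators (fcell j)).
  rewrite /a4 -[(P W).+1 in X in derives X](card_ord (P W).+1).
  apply: derives_bigcup_fin => j.
  apply: derives_le (@derives_bind _ _ _ g
    (fun v => cell_symbol (P := P W) (cfg (time v)) o j) _ _ _).
  - by rewrite card_ffun !card_ord mul2n addn1.
  - by right.
  - by move=> v h Bh; left; exists (time v);
    [exact: timeT | apply: config_wires_cell Bh].
pose isb j x := is_bit (fcell j x).
pose D := \bigcup_(j in setT) indicators (fcell j).
have d5 : derives (a5 W) D (\bigcup_(j in setT) indicators (isb j)).
  rewrite /a5 -[(P W).+1 in X in derives X](card_ord (P W).+1).
  apply: derives_bigcup_fin => j.
  apply: derives_le (derives_map (@is_bit _) (g := fcell j) _).
    by rewrite card_bool.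
  by move=> h Bh; exists j.
pose out x := tm_output (cfg (time (g x)) x).
pose upto j := [seq i : 'I_(P W).+1 <- enum 'I_(P W).+1 | (i : nat) <= j].
have out_bit x j : j < P W -> bit (out x) j =
    all (fun i => isb i x) (upto j) &&
    (fcell (inord j) x == Some (inl true)).
  move=> jP; rewrite /out /tm_output bit_bits_val nth_leading_bits.
  congr (_ && _); last by rewrite /fcell /cell_symbol inordK // ltnS ltnW.
  apply/allP/allP => H i.
    rewrite mem_filter => /andP[ij _]; apply: (H i).
    by rewrite mem_iota.
  rewrite mem_iota /= add0n ltnS => ij.
  have iP : i < (P W).+1 by apply: leq_ltn_trans ij _; rewrite ltnS ltnW.
  have := H (Ordinal iP); rewrite mem_filter ij mem_enum; exact.
have out_lt x : out x < 2 ^ P W.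
  apply: leq_trans (bits_val_lt _) _; rewrite leq_exp2l //.
  apply: leq_trans (size_leading_bits _) _.
  apply: leq_trans (iter_tm_step_size (W := W) _ _ _) _ => [i|].
    by rewrite ffunE.
  by rewrite /P addn1 ltnW // ltnS leq_add2l timeT.
have d6 : derives (a6 W) (D `|` \bigcup_(j in setT) indicators (isb j))
  (digits out).
  apply: derives_digits => // j jP.
  apply: (@derives_trans _ _ _ _ [set fun x =>
      all (fun i => isb i x) (upto j)]).
    apply: derives_le (derives_all (G := isb) _).
      by rewrite ltnS size_filter (leq_trans (count_size _ _)) // size_enum_ord.
    by move=> i _; right; exists i => //; apply: indicators_bool.
  suff -> : (fun x => bit (out x) j) = (fun x =>
      all (fun i => isb i x) (upto j) &&
      (fcell (inord j) x == Some (inl true))).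
    apply: derives1; apply: gate_fun_and; first by right.
    by left; left; exists (inord j) => //; apply: indicators_eq.
  by apply: funext => x; apply: out_bit.
have outE : (fun x => pv_fun (Clocked M c) [ffun i => u i x]) = out.
  apply: funext => x; rewrite /pv_fun /out /cfg /time /=.
  suff -> : \sum_(i < k) binlen ([ffun i0 => u i0 x] i)
    = \sum_(i < k) g x i by [].
  by apply: eq_bigr => i _; rewrite !ffunE inordK // ltnS binlen_le.
rewrite outE; split=> [x|].
  by rewrite -[pv_fun _ _]/((fun x => pv_fun (Clocked M c) [ffun i => u i x])
    x) outE
     (leq_trans (out_lt x)) // leq_exp2l // leq_addr.
have dD := derives_cut (derivesU (derives_cut d0 d1) (derives_cut d2 d3)) d4.
have dI := derives_cut dD (derivesU (derives_sub 0 (fun _ => id)) d5).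
by apply: derives_le (derives_cut dI d6); rewrite add0n leq_addl.
Qed.

End PVFunction.

(** * Circuits for arithmetic *)

(** The carry into digit [t] in the addition of [v] and [w]. *)
Definition carry (v w t : nat) : bool := 2 ^ t <= v %% 2 ^ t + w %% 2 ^ t.

Lemma bit_addn v w t : bit (v + w) t = bit v t (+) bit w t (+) carry v w t.
Proof. by rewrite /bit /carry divnD ?expn_gt0 // !oddD oddb. Qed.

Lemma modn_exp2S v t : v %% 2 ^ t.+1 = v %% 2 ^ t + bit v t * 2 ^ t.
Proof.
have p0 : 0 < 2 ^ t by rewrite expn_gt0.
have E : v = (v %/ 2 ^ t)./2 * 2 ^ t.+1 + (v %% 2 ^ t + bit v t * 2 ^ t).
  have := divn_eq v (2 ^ t); have := odd_double_half (v %/ 2 ^ t).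
  rewrite -/(bit v t) expnS.
  set q := _ %/ _; set r := _ %% _; set d := 2 ^ t; set b := nat_of_bool _.
  clearbody q r d b; move: (q./2) => h qE ->; rewrite -qE -muln2; nia.
rewrite {1}E modnMDl modn_small //.
by have := ltn_pmod v p0; rewrite expnS; case: (bit v t); lia.
Qed.

Lemma carryS v w t : carry v w t.+1 =
  [|| bit v t && bit w t, bit v t && carry v w t | bit w t && carry v w t].
Proof.
rewrite /carry !modn_exp2S expnS.
have p0 : 0 < 2 ^ t by rewrite expn_gt0.
have := ltn_pmod v p0; have := ltn_pmod w p0.
by case: (bit v t); case: (bit w t); rewrite /= ?orbF ?andbF; lia.
Qed.

Section Arithmetic.
Variable X : Type.
Local Open Scope classical_set_scope.

Lemma derives_fun2 (h : bool -> bool -> bool) (f g : X -> bool) A : A f ->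
  A g ->
  derives 30 A [set fun x => h (f x) (g x)].
Proof.
move=> Af Ag.
have d2 : derives (#|{: bool * bool}| * 1) (indicators f `|` indicators g)
  (indicators (fun x => (f x, g x))).
  by apply: derives_pair => e ?; [left|right].
have d3 := derives_map (fun s => h s.1 s.2) (fun (_ : X -> bool) =>
  id : indicators (fun x => (f x, g x)) _ -> _).
have := derives_cut (derives_cut (derivesU (derives_bool Af) (derives_bool Ag))
  d2) d3.
rewrite card_prod card_bool; apply: derivesW => // _ ->; exact: indicators_bool.
Qed.

Lemma derives_fun3 (h : bool -> bool -> bool -> bool) (e f g : X -> bool) A :
  A e -> A f -> A g -> derives 100 A [set fun x => h (e x) (f x) (g x)].
Proof.
move=> Ae Af Ag.
have d2 : derives (#|{: bool * bool}| * 1) (indicators f `|` indicators g)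
  (indicators (fun x => (f x, g x))).
  by apply: derives_pair => ? ?; [left|right].
have d2' := derivesU (derives_bool Ae)
  (derives_cut (derivesU (derives_bool Af) (derives_bool Ag)) d2).
have d3 : derives (#|{: bool * (bool * bool)}| * 1)
  (indicators e `|` indicators (fun x => (f x, g x)))
    (indicators (fun x => (e x, (f x, g x)))).
  by apply: derives_pair => ? ?; [left|right].
have d4 := derives_map (fun s => h s.1 s.2.1 s.2.2)
  (fun (_ : X -> bool) => id : indicators (fun x => (e x, (f x, g x))) _ -> _).
have := derives_cut (derives_cut d2' d3) d4.
rewrite !card_prod card_bool; apply: derivesW => // _ ->;
  exact: indicators_bool.
Qed.

Lemma derives_const m A : derives 2 A (digits (fun _ : X => m)).
Proof.
apply: derivesW (derives_ret true A) => // f [j _ <-].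
by case: (bit m j); [exists true | exists false].
Qed.

Lemma derives_add W (v w : X -> nat) : (forall x, v x < 2 ^ W) ->
  (forall x, w x < 2 ^ W) ->
  derives (300 * W.+1) (digits v `|` digits w) (digits (fun x => v x + w x)).
Proof.
move=> vW wW.
pose c t x := carry (v x) (w x) t.
pose C t := (digits v `|` digits w) `|` [set c t].
have d0 : derives 1 (digits v `|` digits w) (C 0).
  have := derivesU (derives_sub 0 (fun _ => id))
    (derives_false (digits v `|` digits w)).
  apply: derivesW => // f [?|->]; [by left | right].
  by apply: funext => x; rewrite /c /carry !modn1.
have d1 : derives (W.+1 * 100) (C 0) (\bigcup_(t in [set t | t <= W.+1]) C t).
  apply: derives_iter => t _.
  have dt : derives 100 (C t) [set c t.+1].
    suff -> : c t.+1 = (fun x => [|| bit (v x) t && bit (w x) t,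
        bit (v x) t && c t x | bit (w x) t && c t x]).
      apply: (@derives_fun3 (fun a b c => [|| a && b, a && c | b && c]) _ _
        (c t)).
      - by left; left; exists t.
      - by left; right; exists t.
      - by right.
    by apply: funext => x; rewrite /c carryS.
  apply: derivesW (derivesU (derives_sub 0 (fun _ => id)) dt) => // f [?|?].
    by left; left.
  by right.
have d2 : derives (W.+1 * 100 + 1) (\bigcup_(t in [set t | t <= W.+1]) C t)
    (digits (fun x => v x + w x)).
  apply: derives_digits => [x|j jW]; first by rewrite expnS; have := vW x;
    have := wW x; lia.
  suff -> : (fun x => bit (v x + w x) j) =
      (fun x => bit (v x) j (+) bit (w x) j (+) c j x).
    apply: (@derives_fun3 (fun a b c => a (+) b (+) c) _ _ (c j)).
    - by exists 0 => //; left; left; exists j.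
    - by exists 0 => //; left; right; exists j.
    - by exists j; [exact: ltnW | right].
  by apply: funext => x; rewrite bit_addn.
by apply: derives_le (derives_cut (derives_cut d0 d1) d2); lia.
Qed.

Lemma derives_double (v : X -> nat) : derives 1 (digits v)
  (digits (fun x => (v x).*2)).
Proof.
have := derivesU (derives_sub 0 (fun _ => id)) (derives_false (digits v)).
apply: derivesW => // _ [[|j] _ <-]; [right | left].
  by apply: funext => x; rewrite bit0 odd_double.
by exists j => //; apply: funext => x; rewrite bitS doubleK.
Qed.

(** Horner's rule on the binary digits of [m]. *)
Lemma derives_mulc V W m (v : X -> nat) : m < 2 ^ V ->
  (forall x, v x < 2 ^ W) ->
  derives (2 + V * (300 * (V + W).+1 + 1)) (digits v)
    (digits (fun x => m * v x)).
Proof.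
move=> mV vW; elim: V m mV => [|V IH] m mV.
  have -> : m = 0 by move: mV; rewrite expn0; lia.
  exact: derives_const.
have mV2 : m./2 < 2 ^ V by move: mV; rewrite expnS; lia.
have dh := derives_cut (IH _ mV2) (derives_double _).
have e x : m * v x = odd m * v x + (m./2 * v x).*2.
  by rewrite -{1}[m]odd_double_half mulnDl doubleMl.
have [om|em] := boolP (odd m); last first.
  suff -> : (fun x => m * v x) = (fun x => (m./2 * v x).*2).
    by apply: derives_le dh; nia.
  by apply: funext => x; rewrite e (negbTE em).
suff -> : (fun x => m * v x) = (fun x => v x + (m./2 * v x).*2).
  have da : derives (300 * (V.+1 + W).+1)
    (digits v `|` digits (fun x => (m./2 * v x).*2))
     (digits (fun x => v x + (m./2 * v x).*2)).
    apply: derives_add => x; have := vW x => h.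
      by apply: leq_trans h _; rewrite leq_exp2l //; lia.
    apply: (@leq_ltn_trans (m * v x)).
      by rewrite doubleMl leq_mul2r -[leqRHS]odd_double_half leq_addl orbT.
    by rewrite expnD ltn_mul.
  by apply: derives_le (derives_trans dh da); nia.
by apply: funext => x; rewrite e om mul1n.
Qed.

Lemma derives_modn_exp2 W (v : X -> nat) : derives 1 (digits v)
  (digits (fun x => v x %% 2 ^ W)).
Proof.
have := derivesU (derives_sub 0 (fun _ => id)) (derives_false (digits v)).
apply: derivesW => // _ [j _ <-]; have [jW|Wj] := ltnP j W; [left | right].
  exists j => //; apply: funext => x; rewrite /bit {1}(divn_eq (v x) (2 ^ W)).
  have -> : 2 ^ W = (2 ^ (W - j.+1)).*2 * 2 ^ j.
    by rewrite -mul2n -expnS -expnD; congr (2 ^ _); lia.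
  by rewrite mulnA divnMDl ?expn_gt0 // oddD oddM odd_double andbF.
by apply: funext => x; rewrite bit_small // (leq_trans (ltn_pmod _ _))
  ?expn_gt0 // leq_exp2l.
Qed.

Lemma derives_eq W (v w : X -> nat) : (forall x, v x < 2 ^ W) ->
  (forall x, w x < 2 ^ W) ->
  derives (31 * W.+1) (digits v `|` digits w) [set fun x => v x == w x].
Proof.
move=> vW wW; pose e j x := bit (v x) j == bit (w x) j.
have d1 : derives (W * 30) (digits v `|` digits w)
    (\bigcup_(j in [set j | List.In j (iota 0 W)]) [set e j]).
  rewrite -[W in X in derives X](size_iota 0); apply: derives_bigcup => j _.
  by apply: (@derives_fun2 (fun a b => a == b)); [left|right]; exists j.
have d2 : derives (size (iota 0 W)).+1
   (\bigcup_(j in [set j | List.In j (iota 0 W)]) [set e j])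
   [set fun x => all (fun j => e j x) (iota 0 W)].
  by apply: derives_all => j ?; exists j.
have := derives_cut d1 d2; rewrite size_iota.
suff -> : (fun x => v x == w x) = (fun x => all (fun j => e j x) (iota 0 W)).
  by apply: derives_le; lia.
apply: funext => x; apply/eqP/allP => [E j _|H]; first by rewrite /e E.
apply: bit_inj => j; have [jW|Wj] := ltnP j W.
  by apply/eqP/H; rewrite mem_iota.
by rewrite !bit_small // (leq_trans (vW x), leq_trans (wW x)) // leq_exp2l.
Qed.

Lemma derives_if W (b : X -> bool) (v w : X -> nat) A :
  (forall x, v x < 2 ^ W) -> (forall x, w x < 2 ^ W) ->
  A b -> digits v `<=` A -> digits w `<=` A ->
  derives (W * 100 + 1) A (digits (fun x => if b x then v x else w x)).
Proof.
move=> vW wW Ab Av Aw; apply: derives_digits => [x|j _]; first by case: ifP.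
suff -> : (fun x => bit (if b x then v x else w x) j) =
    (fun x => if b x then bit (v x) j else bit (w x) j).
  apply: (@derives_fun3 (fun a b c => if a then b else c)) => //.
    by apply: Av; exists j.
  by apply: Aw; exists j.
by apply: funext => x; case: ifP.
Qed.

End Arithmetic.

(** * There are primes of every length *)

Lemma prod_prime_logn c m : 0 < c -> (forall p, prime p -> p %| c -> p <= m) ->
  c = \prod_(0 <= p < m.+1 | prime p) p ^ logn p c.
Proof.
move=> c0 cm; rewrite -{1}(partnT c0) (widen_partn _ (leq_maxl c m)).
rewrite (big_cat_nat _ (n := m.+1)) //=; last by rewrite ltnS leq_maxr.
rewrite [X in _ * X]big1_seq ?muln1 => [|p /=].
  rewrite [RHS]big_mkcond; apply: eq_bigr => p _.
  by case: ifP => // /negbT np; rewrite lognE (negbTE np).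
rewrite mem_index_iota => /andP[mp _]; rewrite lognE.
by case: and3P => // -[pp _ /(cm _ pp)]; rewrite leqNgt mp.
Qed.

(** Distinct primes that divide [c] occur in its prime decomposition. *)
Lemma prod_primes_le c a b : 0 < c ->
  (forall p, a <= p < b -> prime p -> p %| c) ->
  \prod_(a <= p < b | prime p) p <= c.
Proof.
move=> c0 H; rewrite [leqRHS](@prod_prime_logn c (maxn c b)) //; last first.
  by move=> p _ /(dvdn_leq c0) pc; rewrite leq_max pc.
have [ba|ab] := leqP b a.
  rewrite big_geq // prodn_gt0 // => p; rewrite expn_gt0; case: p => //; lia.
have bM : b <= (maxn c b).+1 by rewrite leqW ?leq_maxr.
rewrite (big_cat_nat _ (m := 0) (n := a)) //=;
  last exact: leq_trans (ltnW ab) bM.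
rewrite (big_cat_nat _ (m := a) (n := b) (p := (maxn c b).+1)) //=;
  last exact: ltnW.
have pos m n : 0 < \prod_(m <= p < n | prime p) p ^ logn p c.
  by rewrite prodn_cond_gt0 // => p /prime_gt0 p0; rewrite expn_gt0 p0.
apply: leq_trans (leq_pmull _ (pos _ _));
  apply: leq_trans (leq_pmulr _ (pos _ _)).
rewrite big_seq_cond [leqRHS]big_seq_cond; apply: leq_prod => p;
  rewrite mem_index_iota => /andP[ab' pp].
rewrite -{1}[p]expn1 leq_exp2l ?prime_gt1 // logn_gt0 mem_primes pp c0 /=.
exact: H.
Qed.

Definition primorial n := \prod_(0 <= p < n.+1 | prime p) p.

(** The two central coefficients in the expansion of [2 ^ (2m + 1)] agree. *)
Lemma bin_odd_half m : 'C((m.*2).+1, m) <= 4 ^ m.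
Proof.
rewrite (_ : 4 ^ m = 2 ^ (m.*2)); last by rewrite -mul2n expnM.
have: \sum_(i < (m.*2).+2) 'C((m.*2).+1, i) = 2 ^ (m.*2).+1.
  by rewrite -[2]/(1 + 1) expnDn; apply: eq_bigr => i _; rewrite !exp1n !muln1.
have i0 : m < (m.*2).+2 by lia.
have i1 : m.+1 < (m.*2).+2 by lia.
rewrite (bigD1 (Ordinal i0)) //= (bigD1 (Ordinal i1)) /=;
  last by rewrite -val_eqE /=; lia.
rewrite -(bin_sub (_ : m.+1 <= _)); last by lia.
rewrite (_ : (m.*2).+1 - m.+1 = m); last by lia.
rewrite expnS; lia.
Qed.

Lemma prime_dvd_fact p m : prime p -> (p %| m`!) = (p <= m).
Proof.
move=> pp; elim: m => [|m IH]; first by rewrite fact0 dvdn1 leqn0;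
  case: p pp => [|[]].
rewrite factS Euclid_dvdM // IH; apply/orP/idP => [[/dvdn_leq-> //|]|];
  first exact: leqW.
by rewrite leq_eqVlt ltnS => /orP[/eqP->|]; [left | right].
Qed.

(** The primes in the upper half of the range up to [2m + 1] divide the
binomial coefficient of [2m + 1] and [m], which is at most [4 ^ m]. *)
Lemma primorial_le n : primorial n <= 4 ^ n.
Proof.
elim/ltn_ind: n => n IH; rewrite /primorial.
case: n IH => [|[|[|n]]] IH.
- by rewrite unlock.
- by rewrite unlock.
- by rewrite unlock.
have [odd_n|even_n] := boolP (odd n); last first.
  have [m [m0 nm]] : exists m, 0 < m /\ n.+3 = (m.*2).+1 by exists (n./2).+1;
    lia.
  rewrite nm (big_cat_nat _ (n := m.+2)) //=; last by lia.
  rewrite (_ : 4 ^ (m.*2).+1 = 4 ^ m.+1 * 4 ^ m); last by rewrite -expnD;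
    congr (4 ^ _); lia.
  apply: leq_mul; first by apply: IH; lia.
  apply: leq_trans (bin_odd_half m).
  apply: prod_primes_le; first by rewrite bin_gt0; lia.
  move=> p /andP[mp pm] pp.
  have: p %| ((m.*2).+1)`! by rewrite prime_dvd_fact.
  rewrite -(@bin_fact (m.*2).+1 m); last by lia.
  rewrite !Euclid_dvdM // !prime_dvd_fact //.
  by case/orP => [//|/orP[]]; lia.
rewrite big_mkcond big_nat_recr //= -big_mkcond /=.
have -> : prime n.+3 = false.
  by apply/negbTE; apply/negP => /even_prime[]; lia.
rewrite muln1; apply: leq_trans (IH n.+2 _) _ => //.
by rewrite leq_exp2l.
Qed.

Lemma central_bin_recr n : n.+1 * 'C((n.+1).*2, n.+1) = 2 * (n.*2).+1
  * 'C(n.*2, n).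
Proof.
rewrite doubleS binS -(@bin_sub (n.*2).+1 n.+1); last by lia.
rewrite (_ : (n.*2).+1 - n.+1 = n); last by lia.
have E := mul_bin_diag (n.*2).+1 n; rewrite /= in E.
have F : 'C((n.*2).+1, n.+1) = 'C((n.*2).+1, n).
  by rewrite -(@bin_sub (n.*2).+1 n.+1); [congr 'C(_, _)|]; lia.
nia.
Qed.

Lemma central_bin_ge n : 0 < n -> 4 ^ n <= n.*2 * 'C(n.*2, n).
Proof.
case: n => // n _; elim: n => [|n IH] //.
have := central_bin_recr n.+1; move: IH; rewrite [4 ^ n.+2]expnS.
move: 'C(n.+1.*2, n.+1) 'C(n.+2.*2, n.+2) (4 ^ n.+1) => c a e; nia.
Qed.

Lemma logn_central_bin p n : prime p -> 0 < n ->
  logn p 'C(n.*2, n) =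
    \sum_(1 <= k < (n.*2).+1) ((n.*2) %/ p ^ k - (n %/ p ^ k).*2).
Proof.
move=> pp n0.
have nn : n <= n.*2 by lia.
have := bin_fact nn; rewrite (_ : n.*2 - n = n); last by lia.
move/(congr1 (logn p)); rewrite !lognM ?muln_gt0 ?fact_gt0 ?bin_gt0 //.
rewrite !logn_fact //.
have -> : \sum_(1 <= k < n.+1) n %/ p ^ k = \sum_(1 <= k < (n.*2).+1) n %/ p ^
  k.
  rewrite [RHS](big_cat_nat _ (n := n.+1)) //=.
  rewrite [X in _ + X]big_nat_cond [X in _ + X]big1 ?addn0 // =>
    k /andP[/andP[nk _] _].
  by rewrite divn_small // (leq_trans nk) // ltnW // ltn_expl // prime_gt1.
rewrite -big_split /= => E.
have H k : (n %/ p ^ k).*2 <= n.*2 %/ p ^ k.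
  have pk : 0 < p ^ k by rewrite expn_gt0 prime_gt0.
  by rewrite leq_divRL // -doubleMl leq_double leq_trunc_div.
rewrite sumnB //.
by rewrite -E; under [X in _ - X]eq_bigr => k _ do rewrite -addnn;
  rewrite addnK.
Qed.

Lemma central_bin_term_le1 n q : n.*2 %/ q - (n %/ q).*2 <= 1.
Proof.
have [->|q0] := posnP q; first by rewrite !divn0.
by have := divnD n n q0; rewrite addnn => ->; case: (q <= _) => /=; lia.
Qed.

(** By Legendre's formula, each power of [p] up to [2n] contributes at most 1
to the exponent of [p]. *)
Lemma pfactor_central_bin_le p n : prime p -> 0 < n ->
  p ^ logn p 'C(n.*2, n) <= n.*2.
Proof.
move=> pp n0; have n20 : 0 < n.*2 by lia.
have := trunc_logP (prime_gt1 pp) n20.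
apply: leq_trans; rewrite leq_exp2l ?prime_gt1 // logn_central_bin //.
set e := trunc_log p n.*2.
have en : e <= n.*2.
  by apply: leq_trans (ltnW (ltn_expl e (prime_gt1 pp))) _;
    apply: trunc_logP (prime_gt1 pp) n20.
rewrite (big_cat_nat _ (n := e.+1)) //=.
rewrite [X in _ + X]big_nat_cond [X in _ + X]big1 ?addn0 =>
  [|k /andP[/andP[ek _] _]].
  apply: leq_trans (leq_sum _ (fun k _ => central_bin_term_le1 n (p ^ k))) _.
  by rewrite sum_nat_const_nat; lia.
rewrite divn_small //; apply: leq_trans (trunc_log_ltn _ (prime_gt1 pp)) _.
by rewrite leq_exp2l ?prime_gt1.
Qed.

Lemma logn_central_bin_le1 p n : prime p -> 0 < n -> n.*2 < p ^ 2 ->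
  logn p 'C(n.*2, n) <= 1.
Proof.
move=> pp n0 np; rewrite -ltnS -(ltn_exp2l _ _ (prime_gt1 pp)).
exact: leq_ltn_trans (pfactor_central_bin_le pp n0) np.
Qed.

(** Here [p] occurs once in the factorial of [n], twice in that of [2n], and
higher powers of [p] exceed [2n]. *)
Lemma logn_central_bin_eq0 p n : prime p -> 2 < p -> p <= n -> n.*2 < 3 * p ->
  logn p 'C(n.*2, n) = 0.
Proof.
move=> pp p2 pn np; have n0 : 0 < n by lia.
rewrite logn_central_bin // big_nat_cond big1 // => k /andP[/andP[k1 _] _].
case: k k1 => // -[|k] _.
  have p0 := prime_gt0 pp; rewrite expn1.
  have -> : n.*2 = 2 * p + (n.*2 - 2 * p) by lia.
  have -> : n = 1 * p + (n - p) by lia.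
  by rewrite !divnMDl // !divn_small //; lia.
rewrite divn_small // (leq_trans np) // (@leq_trans (p * p)) ?leq_mul2r ?p2
  ?orbT //.
by rewrite mulnn leq_exp2l // prime_gt1.
Qed.

(** The primes up to [s] contribute at most [2n] each to the central binomial
coefficient. The larger ones occur to the first power at most, and only up to
[2n / 3], where [primorial_le] bounds their product. *)
Lemma Erdos_bound n s : 2 < n -> n.*2 < s.+1 ^ 2 ->
  (forall p, prime p -> n < p -> p < n.*2 -> False) ->
  4 ^ n <= n.*2 ^ s.+1 * 4 ^ (n.*2 %/ 3).
Proof.
move=> n3 ns noprime; have n0 : 0 < n by lia.
apply: leq_trans (central_bin_ge n0) _; rewrite expnS -mulnA leq_mul2l;
  apply/orP; right.
set c := 'C(_, _).
have c0 : 0 < c by rewrite bin_gt0; lia.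
rewrite (@prod_prime_logn c n.*2) //; last first.
  move=> p pp pc; rewrite -(prime_dvd_fact _ pp); apply: dvdn_trans pc _.
  by rewrite -(@bin_fact n.*2 n) ?dvdn_mulr //; lia.
pose m := n.*2 %/ 3.
have mn : n.*2 < 3 * m.+1 by rewrite /m; lia.
apply: (@leq_trans (\prod_(0 <= p < n.*2.+1 | prime p)
    ((if 0 < p <= s then n.*2 else 1) * (if p <= m then p else 1)))).
  rewrite big_nat_cond [leqRHS]big_nat_cond; apply: leq_prod =>
    p /andP[/andP[_ pn2] pp].
  have p0 := prime_gt0 pp; rewrite p0 /=; case: ifP => ps.
    apply: leq_trans (pfactor_central_bin_le pp n0) _.
    by apply: leq_pmulr; case: ifP.
  rewrite mul1n; have l1 : logn p c <= 1.
    apply: logn_central_bin_le1 => //; apply: leq_trans ns _.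
    by rewrite leq_exp2r // ltnNge ps.
  case: ifP => pm; first by apply: leq_trans (leq_pexp2l p0 l1) _;
    rewrite expn1.
  suff -> : logn p c = 0 by [].
  rewrite /c.
  have [pn|np] := leqP p n.
    by apply: logn_central_bin_eq0 => //; move: mn; rewrite /m in pm *; lia.
  have [] := noprime p pp np.
  rewrite ltn_neqAle -ltnS pn2 andbT; apply/eqP => pE; move: pp np.
  by rewrite pE => /even_prime[]; lia.
rewrite big_split /=; apply: leq_mul.
  rewrite -big_mkcondr /= big_const_seq iter_muln_1 leq_exp2l; last by lia.
  rewrite -size_filter -[leqRHS](size_iota 1); apply: uniq_leq_size.
    exact/filter_uniq/iota_uniq.
  by move=> p; rewrite mem_filter mem_iota add1n ltnS => /andP[/andP[_ ->]].
apply: leq_trans (primorial_le m); rewrite /primorial.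
rewrite (big_cat_nat _ (n := m.+1)) //=; last by rewrite /m; lia.
rewrite [X in _ * X]big_nat_cond [X in _ * X]big1 ?muln1; last first.
  by move=> p /andP[/andP[mp _] _]; rewrite leqNgt mp.
rewrite big_nat_cond [leqRHS]big_nat_cond; apply: leq_prod =>
  p /andP[/andP[_ pm] _].
by rewrite ltnS in pm; rewrite pm.
Qed.

Lemma Erdos_bound_fails h : 7 <= h -> 6 * h * (2 ^ h).+1 < 2 ^ (h.*2).-1.
Proof.
move=> h7; rewrite -(subnK h7); elim: (h - 7) => [|v IH]; first by [].
have -> : (v.+1 + 7).*2.-1 = (v + 7).*2.-1.+2 by lia.
rewrite addSn 3!expnS; move: IH; move: (2 ^ (v + 7).*2.-1) (2 ^ (v + 7)) =>
  a b; nia.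
Qed.

(** The argument of Erdos, with explicit primes where the estimate is too
weak. *)
Lemma prime_between_exp2 t : exists2 p, prime p & 2 ^ t.+1 <= p < 2 ^ t.+2.
Proof.
have [|large] := ltnP t 11.
  case: t => [|[|[|[|[|[|[|[|[|[|[|t]]]]]]]]]]] // _.
  - by exists 2.
  - by exists 5.
  - by exists 11.
  - by exists 17.
  - by exists 37.
  - by exists 67.
  - by exists 131.
  - by exists 257.
  - by exists 521.
  - by exists 1031.
  - by exists 2053.
apply: contrapT => noprime.
(* [2 ^ h] is about the square root of [2n = 2 ^ u]. *)
pose u := t.+2; pose h := u.+1./2.
have h7 : 7 <= h by rewrite /h /u; lia.
have N2 : (2 ^ t.+1).*2 = 2 ^ u by rewrite -mul2n -expnS.
have h2 : 4 ^ 2 ^ t.+1 <= (2 ^ t.+1).*2 ^ (2 ^ h).+1 * 4 ^ ((2 ^ t.+1).*2 %/ 3).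
  apply: Erdos_bound; rewrite ?N2.
  - by rewrite (@leq_trans (2 ^ 2)) // leq_exp2l //; lia.
  - apply: (@leq_ltn_trans ((2 ^ h) ^ 2)); last by rewrite ltn_exp2r.
    by rewrite -expnM leq_exp2l // /h; lia.
  - move=> p pp np pn; apply: noprime; exists p => //.
    by rewrite (ltnW np).
move: h2; rewrite -[4]/(2 ^ 2) N2 -!expnM -expnD leq_exp2l // !mul2n N2 => h2.
have hu : 2 ^ h.*2.-1 <= 2 ^ u by rewrite leq_exp2l // /h; lia.
have u2h : u <= h.*2 by rewrite /h; lia.
have := Erdos_bound_fails h7.
have : u * (2 ^ h).+1 <= h.*2 * (2 ^ h).+1 by rewrite leq_mul2r u2h orbT.
move: hu h2; set a := 2 ^ u; set b := 2 ^ h; set c := 2 ^ _.-1 => hu h2.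
have := leq_divM a 3. move: (a %/ 3) h2 => q h2.
nia.
Qed.

(** * The teacher *)

(** A divisor of a squarefree number is the product of its prime divisors. *)
Lemma dvdn_prod_distinct_primes (I : eqType) (r : seq I) (p : I -> nat) y :
  uniq r -> {in r &, injective p} -> (forall j, j \in r -> prime (p j)) ->
  y %| \prod_(j <- r) p j -> y = \prod_(j <- r | p j %| y) p j.
Proof.
elim: r y => [|j r IH] y.
  by rewrite !big_nil dvdn1 => _ _ _ /eqP.
rewrite /= => /andP[jr ur] inj_p pp; rewrite !big_cons => yd.
have pj := pp j (mem_head _ _).
have inj_r : {in r &, injective p}.
  by move=> i i' ir ir'; apply: inj_p; rewrite inE ?ir ?ir' orbT.
have pr i : i \in r -> prime (p i) by move=> ir; apply: pp; rewrite inE ir orbT.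
have neq i : i \in r -> p i != p j.
  move=> ir; apply: contraNneq jr => /inj_p <- //; first by rewrite inE ir orbT.
  exact: mem_head.
case: ifP => jy; last first.
  apply: IH => //; move: yd; rewrite Gauss_dvdr //.
  by rewrite coprime_sym prime_coprime ?jy.
have [z yE] := dvdnP jy; have p0 := prime_gt0 pj.
move: yd; rewrite yE mulnC dvdn_pmul2l // => zd.
rewrite {1}(IH z ur inj_r pr zd); congr (_ * _).
rewrite big_seq_cond [RHS]big_seq_cond; apply: eq_bigl => i.
have [ir|//] /= := boolP (i \in r).
by have pi := pr i ir; rewrite Euclid_dvdM // (dvdn_prime2 pi pj)
  (negbTE (neq i ir)).
Qed.

Section Teacher.
Variable k : nat.
Notation J := {ffun 'I_k -> bool}.
Implicit Types (a b : J) (S : {set J}) (p : J -> nat).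

(** Positions are the leaves of a binary tree of height [k]: two leaves agree
up to [i] if they lie below the same node of level [i]. *)
Definition agree i a b := [forall l : 'I_k, (l < i) ==> (a l == b l)].
Definition block i a : {set J} := [set b | agree i a b].
Definition respects i S :=
  [forall a, forall b, agree i a b ==> ((a \in S) == (b \in S))].
Definition subprod p S := \prod_(j in S) p j.
Definition reply i S : {set J} := if [pick a in S] is Some a then block i.+1 a
  else finset.set0.
Definition admissible i : seq {set J} :=
  [seq S <- enum {: {set J}} | respects i S && (S != finset.set0)].
(** The search is written as a fold of conditionals, which a circuit imitates
directly. The answer 0 refutes every number that is not a divisor of [x] above
1. *)
Definition answer p i y :=
  foldr (fun S z => if subprod p S == y then subprod p (reply i S) else z) 0
    (admissible i).

Lemma agreeP i a b : reflect (forall l : 'I_k, l < i -> a l = b l)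
  (agree i a b).
Proof.
apply: (iffP forallP) => H l; first by move/(implyP (H l))/eqP.
by apply/implyP => /H/eqP.
Qed.

Lemma agree_le i i' a b : i <= i' -> agree i' a b -> agree i a b.
Proof.
by move=> ii' /agreeP H; apply/agreeP => l li; apply: H; apply: leq_trans ii'.
Qed.

Lemma respectsP i S a b : respects i S -> agree i a b -> (a \in S) = (b \in S).
Proof. by move=> /forallP/(_ a)/forallP/(_ b)/implyP H /H/eqP. Qed.

Lemma block_agree i i' a b c : i <= i' -> agree i' a b -> (a \in block i c)
  = (b \in block i c).
Proof.
move=> ii' /(agree_le ii')/agreeP ab; rewrite !inE.
by apply/agreeP/agreeP => H l li; rewrite H ?ab.
Qed.

Lemma reply_agree i i' S a b : i < i' -> agree i' a b -> (a \in reply i S)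
  = (b \in reply i S).
Proof.
move=> ii' ab; rewrite /reply; case: pickP => [c _|_];
  first exact: block_agree ii' ab.
by rewrite !inE.
Qed.

Lemma reply_proper i S : i < k -> respects i S -> S != finset.set0 ->
  (reply i S \proper S) && (reply i S != finset.set0).
Proof.
move=> ik rS S0; rewrite /reply; case: pickP => [a aS|S_0]; last first.
  by case/set0Pn: S0 => a; rewrite S_0.
apply/andP; split; last by apply/set0Pn; exists a; rewrite inE; apply/agreeP.
apply/properP; split.
  apply/fintype.subsetP => b; rewrite inE => /(agree_le (leqnSn i)) ab.
  by rewrite -(respectsP rS ab).
(* The leaf [b] leaves the path to [a] at level [i]. *)
pose b : J := [ffun l => if l == Ordinal ik then ~~ a l else a l].
have ab : agree i a b.
  apply/agreeP => l li; rewrite ffunE; case: eqP => // E.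
  by move: li; rewrite E ltnn.
exists b; first by rewrite -(respectsP rS ab).
rewrite inE; apply/agreeP => /(_ (Ordinal ik) (leqnn _)).
by rewrite ffunE eqxx; case: (a _).
Qed.

Lemma answerP p i y :
  (exists2 S, respects i S && (S != finset.set0) &
     y = subprod p S /\ answer p i y = subprod p (reply i S)) \/
  answer p i y = 0 /\ (forall S, respects i S -> S != finset.set0 ->
    y <> subprod p S).
Proof.
have H : forall r : seq {set J}, let z :=
    foldr (fun S z => if subprod p S == y then subprod p (reply i S) else z) 0
      r in
  (exists2 S, S \in r & y = subprod p S /\ z = subprod p (reply i S)) \/
  z = 0 /\ (forall S, S \in r -> y <> subprod p S).
  elim=> [|S r IH] /=; first by right.
  case: eqP => [<-|nS]; first by left; exists S; rewrite ?mem_head.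
  case: IH => [[S' S'r HS']|[-> HS']]; first by left; exists S' => //;
    rewrite inE S'r orbT.
  right; split=> // S'; rewrite inE => /orP[/eqP->|];
    [exact/nesym | exact: HS'].
case: (H (admissible i)) => [[S]|[H0 HS]].
  by rewrite mem_filter => /andP[rS _] HS; left; exists S.
by right; split=> // S rS S0; apply: HS; rewrite mem_filter rS S0 mem_enum.
Qed.

Section Primes.
Variable p : J -> nat.
Hypothesis p_prime : forall j, prime (p j).
Hypothesis p_inj : injective p.

Lemma dvdn_subprod j S : (p j %| subprod p S) = (j \in S).
Proof.
apply/idP/idP => [|jS]; last by rewrite /subprod (bigD1 j) //= dvdn_mulr.
rewrite /subprod Euclid_dvd_prod // big_has_cond => /hasP[l _ /andP[lS]].
by rewrite dvdn_prime2 // => /eqP/p_inj ->.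
Qed.

Lemma subprod_gt0 S : 0 < subprod p S.
Proof. by rewrite prodn_cond_gt0 // => j _; apply: prime_gt0. Qed.

Lemma subprod_sub S S' : S \subset S' -> subprod p S %| subprod p S'.
Proof.
move=> SS'; rewrite /subprod [X in _ %| X](bigID (mem S)) /=.
apply: dvdn_mulr; rewrite [X in _ %| X](eq_bigl (mem S)) // => j /=.
apply: andb_idl; exact: (fintype.subsetP SS').
Qed.

Lemma dvdn_subprodE y : y %| subprod p finset.setT -> y
  = subprod p [set j | p j %| y].
Proof.
rewrite /subprod (eq_bigl xpredT) => [yd|j]; last by rewrite inE.
rewrite [LHS](@dvdn_prod_distinct_primes _ (index_enum J) p y
  (index_enum_uniq _)) //.
  by apply: eq_bigl => j; rewrite inE.
by move=> i j _ _; apply: p_inj.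
Qed.

(** If [y] is at least 2 and divides [x], then it is the product over a
nonempty set [S], which is a union of blocks of level [i]. A block of level
[i + 1] inside [S] is nonempty and proper, so its product is a nontrivial
divisor of [y]. *)
Lemma answer_refutes i y : i < k ->
  (forall S, y = subprod p S -> respects i S) ->
  refutes (subprod p finset.setT) y (answer p i y).
Proof.
move=> ik y_resp; apply/implyP => _.
case: (answerP p i y) => [[S /andP[rS S0] [yE ->]]|[-> yN]].
  have /andP[/properP[sub [b bS bR]] /set0Pn[a aR]] := reply_proper ik rS S0.
  have zy := subprod_sub sub; rewrite -yE in zy.
  rewrite dvdn_leq ?yE ?subprod_gt0 //= -?yE //; apply/negP => /and3P[_ _].
  rewrite zy /= => /orP[] /eqP E.
    by have := dvdn_subprod a (reply i S); rewrite E aR dvdn1 => /eqP p1;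
       have := prime_gt1 (p_prime a); rewrite p1.
  by have := dvdn_subprod b (reply i S);
    rewrite E yE dvdn_subprod bS (negbTE bR).
rewrite /=; apply/negP => /and3P[y2 yx _].
have yE := dvdn_subprodE yx; apply: (yN _ (y_resp _ yE) _ yE).
apply/eqP => E; move: y2; rewrite yE E.
by rewrite /subprod big_set0.
Qed.

End Primes.

(** The level at which the teacher answers a candidate. *)
Fixpoint depth (d : play) : nat :=
  match d with
  | Start => 0
  | Reply d => (depth d).+1
  | @Apply n f a => \max_(i < n) depth (a i)
  end.

Fixpoint outcome p (d : play) : nat :=
  match d with
  | Start => subprod p finset.setT
  | Reply d => answer p (depth d) (outcome p d)
  | Apply _ f a => pv_fun f [ffun i => outcome p (a i)]
  end.

Lemma run_outcome p : run (outcome p).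
Proof. by []. Qed.

End Teacher.

(** * The student factors *)

Section Simulation.
Variables (k : nat).
Notation J := {ffun 'I_k -> bool}.
Variables a b : J.
Hypothesis ab : a != b.

(** The values of [V] are computed from the product [p a * p b] alone, by
circuits of polynomial size in the length of the numbers [p j]. The values of
[p] off [a] and [b] are constants of the circuit. *)
Definition poly_computed (V : (J -> nat) -> nat) : Prop :=
  exists Q, poly_bounded Q /\
  forall n (X : Type) (p : X -> J -> nat) (w : J -> nat),
    (forall j, w j < 2 ^ n) -> (forall x j, p x j < 2 ^ n) ->
    (forall x j, j != a -> j != b -> p x j = w j) ->
    (forall x, V (p x) < 2 ^ Q n) /\
    derives (Q n) (digits (fun x => p x a * p x b)) (digits (fun x => V (p x))).

Lemma subprod_lt_exp2 (S : {set J}) (w : J -> nat) n : (forall j, w j < 2 ^ n)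
  ->
  subprod w S < 2 ^ (n * #|{: J}| + 1).
Proof.
move=> wn; apply: (@leq_ltn_trans (2 ^ (n * #|{: J}|)));
  last by rewrite ltn_exp2l // addn1.
apply: (@leq_trans (\prod_(j in S) 2 ^ n)).
  by apply: leq_prod => j _; apply: ltnW.
by rewrite prod_nat_const -expnM leq_exp2l // leq_mul2l max_card orbT.
Qed.

Lemma eq_subprod (S : {set J}) (p w : J -> nat) : (forall j, j \in S -> p j
  = w j) ->
  subprod p S = subprod w S.
Proof. by move=> pw; apply: eq_bigr. Qed.

Lemma poly_computed_subprod (S : {set J}) : (a \in S) = (b \in S) ->
  poly_computed (fun p => subprod p S).
Proof.
move=> abS; pose V n := n * #|{: J}| + 1; pose Q n :=
  2 + V n * (300 * (V n + n.*2).+1 + 1) + V n.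
have pV : poly_bounded V by rewrite /V; poly_bound.
exists Q; split; first by rewrite /Q; poly_bound.
move=> n X p w wn pn pw; split=> [x|].
  apply: leq_trans (subprod_lt_exp2 S (pn x)) _.
  by rewrite leq_exp2l // /Q leq_addl.
have [aS|aS] := boolP (a \in S); last first.
  suff -> : (fun x => subprod (p x) S) = (fun=> subprod w S).
    by apply: derives_le (derives_const _ _); rewrite /Q -addnA leq_addr.
  apply: funext => x; apply: eq_subprod => j jS; apply: pw.
    by apply: contraNneq aS => <-.
  by apply: contraNneq aS => E; rewrite abS -E.
suff -> : (fun x => subprod (p x) S)
  = (fun x => subprod w (S :\ a :\ b) * (p x a * p x b)).
  apply: derives_le (derives_mulc (V := V n) (W := n.*2) _ _).
  - by rewrite /Q leq_addr.
  - exact: subprod_lt_exp2.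
  - by move=> x; rewrite -addnn expnD ltn_mul.
apply: funext => x; rewrite /subprod (big_setD1 a) //= (big_setD1 b) /=;
  last first.
  by rewrite !inE -abS aS eq_sym ab.
rewrite mulnA mulnC; congr (_ * _); apply: eq_bigr => j.
by rewrite !inE => /andP[jb /andP[ja _]]; apply: pw.
Qed.

Lemma poly_computed_zero : poly_computed (fun=> 0).
Proof.
exists (fun=> 2); split; first exact: poly_bounded_const.
by move=> n X p w _ _ _; split=> // ; apply: derives_const.
Qed.

Lemma poly_computed_if U V Z Z' : poly_computed U -> poly_computed V ->
  poly_computed Z -> poly_computed Z' ->
  poly_computed (fun p => if U p == V p then Z p else Z' p).
Proof.
move=> [QU [pU eU]] [QV [pV eV]] [QZ [pZ eZ]] [QZ' [pZ' eZ']].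
pose W n := QU n + QV n + QZ n + QZ' n.
exists (fun n => W n + 31 * (W n).+1 + (W n * 100 + 1)); split.
  by rewrite /W; poly_bound.
move=> n X p w wn pn pw.
have [UW dU] := eU n X p w wn pn pw; have [VW dV] := eV n X p w wn pn pw.
have [ZW dZ] := eZ n X p w wn pn pw; have [ZW' dZ'] := eZ' n X p w wn pn pw.
have le_exp2 v Q : Q <= W n -> v < 2 ^ Q -> v < 2 ^ W n.
  by move=> QW vQ; apply: leq_trans vQ _; rewrite leq_exp2l.
have [U1 V1] : (forall x, U (p x) < 2 ^ W n) /\ (forall x, V (p x) < 2 ^ W n).
  by split=> x; [apply: le_exp2 (UW x)|apply: le_exp2 (VW x)]; rewrite /W; lia.
have [Z1 Z1'] : (forall x, Z (p x) < 2 ^ W n) /\ (forall x, Z' (p x) < 2 ^ W n).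
  by split=> x; [apply: le_exp2 (ZW x)|apply: le_exp2 (ZW' x)]; rewrite /W; lia.
split=> [x|].
  by apply: (@leq_trans (2 ^ W n));
    [case: ifP | rewrite leq_exp2l // -addnA leq_addr].
have d1 := derivesU (derivesU dU dV) (derivesU dZ dZ').
pose ZZ := (digits (fun x => Z (p x)) `|` digits (fun x => Z' (p x)))%classic.
pose UV := (digits (fun x => U (p x)) `|` digits (fun x => V (p x)))%classic.
pose B := ([set fun x => U (p x) == V (p x)] `|` ZZ)%classic.
have d2 : derives (31 * (W n).+1 + 0) (UV `|` ZZ)%classic B.
  apply: derivesU; last by apply: derives_sub => f; right.
  by apply: derivesW (derives_eq U1 V1) => // f; left.
have d3 : derives (W n * 100 + 1) B
  (digits (fun x => if U (p x) == V (p x) then Z (p x) else Z' (p x))).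
  apply: (@derives_if _ _ (fun x => U (p x) == V (p x))) => //; first by left.
    by move=> f ?; right; left.
  by move=> f ?; right; right.
by apply: derives_le (derives_cut (derives_cut d1 d2) d3); rewrite /W; lia.
Qed.

Lemma poly_computed_pv m (f : PV m) (V : 'I_m -> (J -> nat) -> nat) :
  (forall i, poly_computed (V i)) ->
    poly_computed (fun p => pv_fun f [ffun i => V i p]).
Proof.
move=> /choice[Q HQ]; have pQ i := (HQ i).1.
pose W n := \sum_(i < m) Q i n.
have pW : poly_bounded W := poly_bounded_sum pQ.
have [R [pR HR]] := pv_fun_derives f.
exists (fun n => m * W n + R (W n)); split.
  by apply: poly_boundedD; [poly_bound | apply: (poly_bounded_comp pR pW)].
move=> n X p w wn pn pw.
have QW i : Q i n <= W n by rewrite /W (bigD1 i) //= leq_addr.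
have [|lt d] := HR (W n) X (fun i x => V i (p x)).
  move=> i x; have [H _] := (HQ i).2 n X p w wn pn pw.
  by apply: leq_trans (H x) _; rewrite leq_exp2l.
split=> [x|]; first by apply: leq_trans (lt x) _; rewrite leq_exp2l // leq_addl.
apply: derives_cut d; rewrite -{1}(card_ord m); apply: derives_bigcup_fin => i.
have [_ di] := (HQ i).2 n X p w wn pn pw.
exact: derives_le di.
Qed.

(** Every set that the teacher considers at level [j] is a union of blocks of
level at most [i], so it does not separate [a] from [b]. *)
Lemma poly_computed_answer i j V : j < i -> agree i a b -> poly_computed V ->
  poly_computed (fun p => answer p j (V p)).
Proof.
move=> ji sab eV; rewrite /answer.
have : forall S, S \in admissible k j -> (a \in S) = (b \in S).
  move=> S; rewrite mem_filter => /andP[/andP[rS _] _].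
  exact/(respectsP rS)/(agree_le (ltnW ji) sab).
elim: (admissible k j) => [|S r IH] rS; first exact: poly_computed_zero.
apply: poly_computed_if => //.
- by apply: poly_computed_subprod; apply: rS; apply: mem_head.
- by apply: poly_computed_subprod; apply: reply_agree ji sab.
- by apply: IH => S' S'r; apply: rS; rewrite inE S'r orbT.
Qed.

Lemma poly_computed_outcome i d : depth d <= i -> agree i a b ->
  poly_computed (fun p => outcome p d).
Proof.
move=> di sab; elim/play_nested_ind: d di => [|d IH|m f V IH] /= di.
- by apply: poly_computed_subprod; rewrite !inE.
- by apply: poly_computed_answer di sab (IH (ltnW di)).
- apply: poly_computed_pv => l; apply: IH; apply: leq_trans di.
  by rewrite (bigmax_sup l).
Qed.

End Simulation.

Lemma bits_val_mkseq v n : v < 2 ^ n -> bits_val (mkseq (bit v) n) = v.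
Proof.
move=> vn; apply: bit_inj => i; rewrite bit_bits_val.
have [lt|ge] := ltnP i n; first by rewrite nth_mkseq.
by rewrite nth_default ?size_mkseq // bit_small // (leq_trans vn) // leq_exp2l.
Qed.

Lemma number_circuit n s (X : Type) (N out : X -> nat) :
  (forall x, N x < 2 ^ n.*2) -> (forall x, out x < 2 ^ n) ->
  derives s (digits N) (digits out) ->
  exists C : circuit n.*2, circuit_size C <= n.*2 + s.+1 + n /\
    forall x, circuit_num C (N x) = out x.
Proof.
move=> N2 outn d.
pose inp x := [tuple bit (N x) i | i < n.*2].
have d0 : derives 1 [set (fun x => tnth (inp x) i) |
  i in [set: 'I_n.*2]]%classic (digits N).
  have := derivesU (derives_sub 0 (fun _ => id)) (derives_false
    [set (fun x => tnth (inp x) i) | i in [set: 'I_n.*2]]%classic).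
  apply: derivesW => // _ [j _ <-]; have [jn|nj] := ltnP j n.*2.
    left; exists (Ordinal jn) => //; apply: funext => x.
    by rewrite tnth_mktuple.
  by right; apply: funext => x; rewrite bit_small // (leq_trans (N2 x)) //
    leq_exp2l.
pose outs := [seq (fun x => bit (out x) j) | j <- iota 0 n].
have d1 : derives (1 + s) [set (fun x => tnth (inp x) i) |
  i in [set: 'I_n.*2]]%classic
    [set f | List.In f outs]%classic.
  apply: derivesW (derives_cut d0 d) => // f /List.in_map_iff[j [<- _]].
  by exists j.
have [C [szC CE]] := derives_circuit d1.
exists C; split; first by move: szC; rewrite size_map size_iota; lia.
move=> x; rewrite /circuit_num -/(inp x) CE -[RHS](bits_val_mkseq (outn x)).
by rewrite -map_comp.
Qed.

(** Exact division by an odd number is multiplication modulo a power of two,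
which circuits perform more easily. *)
Lemma odd_inverse_mod n D : odd D ->
  exists2 D', D' < 2 ^ n & forall u, u < 2 ^ n -> D' * (u * D) %% 2 ^ n = u.
Proof.
move=> oD; have D0 : 0 < D by case: D oD.
have cop : gcdn D (2 ^ n) = 1 by apply/eqP/coprimeXr; rewrite coprimen2.
case: (egcdnP (2 ^ n) D0) => km kn E _; rewrite cop in E.
exists (km %% 2 ^ n); first by rewrite ltn_pmod // expn_gt0.
move=> u un; rewrite modnMml mulnCA E mulnDr muln1 mulnA modnMDl.
by rewrite modn_small.
Qed.

Section FactorCircuit.
Variable k : nat.
Notation J := {ffun 'I_k -> bool}.

Definition plug (T : Type) (w : {ffun J -> T}) (ab : J * J) (uv : T * T) :
  {ffun J -> T} :=
  [ffun j => if j == ab.1 then uv.1 else if j == ab.2 then uv.2 else w j].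

Definition nums n (w : {ffun J -> 'I_(2 ^ n)}) (j : J) : nat := w j.

(** The candidate equals the prime at [a] times a constant, the product over
[S] without [a], because [b] is not in [S]. *)
Lemma factor_circuit (d : play) (S : {set J}) (a b : J) :
  agree (depth d) a b -> a \in S -> b \notin S ->
  exists c, forall n (w : {ffun J -> 'I_(2 ^ n)}), (forall j, odd (w j)) ->
    exists2 C : circuit n.*2, circuit_size C <= n ^ c + c &
      forall uv, let p := nums (plug w (a, b) uv) in
        outcome p d = subprod p S -> circuit_num C (uv.1 * uv.2) = uv.1.
Proof.
move=> sab aS bS; have ab : a != b by apply: contraNneq bS => <-.
have [Q [pQ HQ]] := poly_computed_outcome ab (leqnn _) sab.
pose R n := n.*2 + (Q n + (2 + n * (300 * (n + Q n).+1 + 1)) + 1).+1 + n.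
have [c Rc] : poly_bounded R.
  by rewrite /R; poly_bound.
exists c => n w ow.
pose p (uv : 'I_(2 ^ n) * 'I_(2 ^ n)) := nums (plug w (a, b) uv).
have pa uv : p uv a = uv.1 by rewrite /p /nums ffunE eqxx.
have pb uv : p uv b = uv.2 by rewrite /p /nums ffunE /= eq_sym (negbTE ab) eqxx.
have pw uv j : j != a -> j != b -> p uv j = nums w j.
  by rewrite /p /nums ffunE /= => /negbTE-> /negbTE->.
have [lt dQ] := HQ n _ p (nums w) (fun j => ltn_ord _) (fun uv j => ltn_ord _)
  pw.
pose D := subprod (nums w) (S :\ a).
have oD : odd D.
  by rewrite /D /subprod (big_morph odd oddM (id1 := true)) // big1 // => j _;
    apply: ow.
have [D' D'n D'E] := odd_inverse_mod n oD.
pose out uv := D' * outcome (p uv) d %% 2 ^ n.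
have dout := derives_cut (derives_cut dQ (derives_mulc D'n lt))
  (derives_modn_exp2 n _).
have [||C [szC CE]] := @number_circuit n _ _ _ out _ _ dout.
- by move=> uv; rewrite pa pb -addnn expnD ltn_mul.
- by move=> uv; rewrite ltn_pmod // expn_gt0.
exists C; first by apply: leq_trans szC (Rc n).
move=> uv /= E; have := CE uv; rewrite pa pb => ->; rewrite /out E.
rewrite /subprod (big_setD1 a aS) /= -/(p uv) pa.
suff -> : \prod_(j in S :\ a) p uv j = D by apply: D'E; apply: ltn_ord.
apply: eq_bigr => j; rewrite !inE => /andP[ja jS]; apply: pw => //.
by apply: contraNneq bS => <-.
Qed.

End FactorCircuit.

(** * Averaging over the other primes *)

Section Averaging.
Variables (k : nat) (T : finType) (A : {set T}).
Notation J := {ffun 'I_k -> bool}.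

Lemma plugK (w : {ffun J -> T}) ab uv : plug (plug w ab uv) ab (w ab.1, w ab.2)
  = w.
Proof.
apply/ffunP => j; rewrite !ffunE /=.
by case: eqP => [->|_] //; case: eqP => [->|].
Qed.

(** Swapping the values of [w] at the two positions with the pair [uv] is an
involution, after which the summand does not depend on the pair. *)
Lemma sum_plug (ab : J * J) (F : {ffun J -> T} -> nat) : ab.1 != ab.2 ->
  \sum_(w in ffun_on A) \sum_(uv in finset.setX A A) F (plug w ab uv) =
  #|A| ^ 2 * \sum_(w in ffun_on A) F w.
Proof.
move=> nab; rewrite pair_big /=.
pose phi (x : {ffun J -> T} * (T * T)) :=
  (plug x.1 ab x.2, (x.1 ab.1, x.1 ab.2)).
have phiK : involutive phi.
  case=> w [u v]; rewrite /phi /= plugK /plug !ffunE eqxx /=.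
  by rewrite eq_sym (negbTE nab) eqxx.
rewrite (reindex_inj (inv_inj phiK)) /=.
pose dom (x : {ffun J -> T} * (T * T)) := (x.1 \in ffun_on A) &&
  (x.2 \in finset.setX A A).
have dom_phi x : dom x -> dom (phi x).
  rewrite /dom !inE /= => /andP[/ffun_onP wA /andP[uA vA]]; rewrite !wA !andbT.
  by apply/ffun_onP => j; rewrite ffunE; case: ifP => // _; case: ifP.
rewrite (eq_bigl dom) => [|x]; last first.
  apply/idP/idP => H; last exact: (dom_phi x H).
  by rewrite -(phiK x); apply: (dom_phi (phi x) H).
rewrite (eq_bigr (fun x => F x.1)); last by move=> x _; rewrite plugK.
rewrite -(pair_big (mem (ffun_on A)) (mem (finset.setX A A)) (fun w _ => F w))
  /=.
rewrite big_distrr /=; apply: eq_bigr => w _.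
by rewrite sum_nat_const cardsX mulnn.
Qed.

(** Some event has frequency at least the inverse of [#|E|] among all [w]. By
[sum_plug] this is an average over [w] of the frequencies among the pairs put
at two given positions, one of which is therefore as large. *)
Lemma averaging (E : finType) (ab : E -> J * J) (ev : E -> pred {ffun J -> T}) :
  0 < #|A| -> (forall e w, ev e w -> (ab e).1 != (ab e).2) ->
  (forall w, w \in ffun_on A -> exists e, ev e w) ->
  exists e w, [/\ w \in ffun_on A, (ab e).1 != (ab e).2 & #|A| ^ 2 <=
    #|E| * #|[set uv in finset.setX A A | ev e (plug w (ab e) uv)]|].
Proof.
move=> A0 evab cover; apply: contrapT => none.
pose n := #|ffun_on A : pred {ffun J -> T}|.
have n0 : 0 < n by rewrite /n card_ffun_on expn_gt0 A0.
have small e : #|E| * \sum_(w in ffun_on A) ev e w < n.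
  have [eab|eab] := boolP ((ab e).1 == (ab e).2).
    rewrite big1 ?muln0 // => w _; apply/eqP; rewrite eqb0; apply/negP => /evab.
    by rewrite eab.
  rewrite -(@ltn_pmul2l (#|A| ^ 2)) ?expn_gt0 ?A0 // mulnCA
    -(sum_plug (fun w => nat_of_bool (ev e w)) eab).
  rewrite big_distrr /= [ltnRHS]mulnC -sum_nat_const.
  rewrite /n in n0; have [w0 w0A] := card_gt0P n0.
  have lt w : w \in ffun_on A -> #|E| * \sum_(uv in finset.setX A A) ev e
    (plug w (ab e) uv)
      < #|A| ^ 2.
    move=> wA; rewrite ltnNge; apply/negP => le; apply: none; exists e, w;
      split=> //.
    apply: leq_trans le _; rewrite leq_mul2l -sum1dep_card big_mkcondr /=.
    by apply/orP; right; apply: leq_sum => uv _; case: (ev _ _).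
  rewrite (bigD1 w0) //= [ltnRHS](bigD1 w0) //= -addSn; apply: leq_add;
    first exact: lt.
  by apply: leq_sum => w /andP[wA _]; apply/ltnW/lt.
have : n <= \sum_(e : E) \sum_(w in ffun_on A) ev e w.
  rewrite exchange_big /= /n -sum1_card; apply: leq_sum => w /cover[e ew].
  by rewrite (bigD1 e) //= ew.
have [w0 w0A] := card_gt0P n0; have [e0 _] := cover w0 w0A.
have E0 : 0 < #|E| by apply/card_gt0P; exists e0.
rewrite -(leq_pmul2l E0) big_distrr /= leqNgt => /negP[].
rewrite -sum_nat_const (bigD1 e0) //= [ltnRHS](bigD1 e0) //= -addSn.
apply: leq_add; first exact: small.
by apply: leq_sum => e _; apply/ltnW/small.
Qed.

End Averaging.

(** * Factoring from a winning student *)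

(** At [n = 0] the additive constant makes up for [0 ^ 0 = 1]. *)
Lemma leq_exp_add n c c' : c <= c' -> n ^ c + c <= n ^ c' + c'.
Proof.
case: n => [|n] cc'; last by rewrite leq_add // leq_pexp2l.
by case: c cc' => [|c]; case: c' => [|c'] // cc'; rewrite ?expn0 ?exp0n //; lia.
Qed.

Lemma uniform_bound (I : finType) (P : I -> nat -> Prop) :
  (forall i c c', c <= c' -> P i c -> P i c') -> (forall i, exists c, P i c) ->
  exists c, forall i, P i c.
Proof.
move=> mono /choice[f Pf]; exists (\max_i f i) => i.
by apply: mono (Pf i); apply: leq_bigmax.
Qed.

Lemma In_nth_play (d : play) L : List.In d L -> exists i : 'I_(size L),
  nth Start L i = d.
Proof.
elim: L => //= e L IH [<-|/IH[i iE]]; first by exists ord0.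
by exists (lift ord0 i).
Qed.

Lemma constant_circuit : exists c, forall n m, m < 2 ^ n ->
  exists2 C : circuit n.*2, circuit_size C <= n ^ c + c &
    forall x, x < 2 ^ n.*2 -> circuit_num C x = m.
Proof.
have [c Hc] : poly_bounded (fun n => n.*2 + 3 + n).
  by poly_bound.
exists c => n m mn.
have [|//|C [szC CE]] := @number_circuit n 2 'I_(2 ^ n.*2) val (fun=> m) _ _
  (derives_const _ _).
  by move=> x; apply: ltn_ord.
exists C; first exact: leq_trans szC (Hc n).
by move=> x x2; apply: (CE (Ordinal x2)).
Qed.

Lemma primes_of_lenP n (p : 'I_(2 ^ n)) : 0 < n ->
  (p \in primes_of_len n) = prime p && (2 ^ n <= p.*2).
Proof.
case: n p => // n p _; rewrite inE; congr (_ && _).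
have pn : binlen p <= n.+1 by rewrite binlen_le.
rewrite eqn_leq pn /= leqNgt.
have E : 2 ^ n.+1 = (2 ^ n).*2 by rewrite expnS mul2n.
by rewrite ltnS binlen_le -leqNgt -leq_double -E.
Qed.

Lemma primes_of_len_gt0 n : 2 <= n -> 0 < #|primes_of_len n|.
Proof.
case: n => [|[|n]] // _; have [p pp /andP[pn np]] := prime_between_exp2 n.
apply/card_gt0P; exists (Ordinal np); rewrite primes_of_lenP //= pp /=.
by rewrite expnS mul2n leq_double.
Qed.

Definition successes n (C : circuit n.*2) :=
  [set pq in finset.setX (primes_of_len n) (primes_of_len n)
       | circuit_num C (pq.1 * pq.2)%N \in [:: val pq.1; val pq.2]].

Section Factoring.
Variables (k : nat) (L : seq play).
Notation J := {ffun 'I_k -> bool}.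

Lemma agree_sym i (a b : J) : agree i a b = agree i b a.
Proof. by apply/agreeP/agreeP => H l li; rewrite H. Qed.

(** Either the value of a play in the list is a product that separates two
positions of a common block, or the primes at two positions coincide. *)
Definition event : finType := (('I_(size L) * {set J}) * (J * J) + J * J)%type.
Definition positions (e : event) : J * J :=
  match e with inl x => x.2 | inr x => x end.
Definition occurs n (e : event) (w : {ffun J -> 'I_(2 ^ n)}) : bool :=
  match e with
  | inl x => let d := nth Start L x.1.1 in
     [&& agree (depth d) x.2.1 x.2.2, x.2.1 \in x.1.2, x.2.2 \notin x.1.2
       & outcome (nums w) d == subprod (nums w) x.1.2]
  | inr x => (x.1 != x.2) && (w x.1 == w x.2)
  end.

Hypothesis student_wins : forall p : J -> nat, injective p ->
  (forall j, prime (p j)) ->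
  exists2 d, List.In d L & exists2 S, outcome p d = subprod p S & ~~ respects
    (depth d) S.

Lemma some_event_occurs n (w : {ffun J -> 'I_(2 ^ n)}) :
  (forall j, prime (w j)) -> exists e, occurs e w.
Proof.
move=> pw; have [inj_w|] := boolP (injectiveb w); last first.
  move=> /injectivePn[a [b ab wab]]; exists (inr (a, b)) => /=.
  by rewrite ab wab eqxx.
have inj_nums : injective (nums w).
  by move=> a b /val_inj; apply: (injectiveP _ inj_w).
have [d dL [S oS nS]] := student_wins inj_nums pw.
have [l lE] := In_nth_play dL.
have [a [b [sab aS bS]]] : exists a b,
  [/\ agree (depth d) a b, a \in S & b \notin S].
  move: nS; rewrite negb_forall => /existsP[a]; rewrite negb_forall =>
    /existsP[b].
  rewrite negb_imply => /andP[sab]; case aS: (a \in S); case bS: (b \in S) =>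
    //= _.
    by exists a, b; rewrite sab aS bS.
  by exists b, a; rewrite agree_sym sab aS bS.
by exists (inl ((l, S), (a, b))); rewrite /= lE sab aS bS oS eqxx.
Qed.

(** Averaging yields an event that is frequent among the pairs at its two
positions. If there are many primes, it is not a coincidence, which has
frequency [1 / #|P|]; so it is a separation, and [factor_circuit] applies. If
there are few, the circuit outputs one of them. *)
Lemma factoring_circuits : exists K c, 0 < K /\ forall n,
  exists C : circuit n.*2,
  circuit_size C <= n ^ c + c /\
    (2 <= n -> #|primes_of_len n| ^ 2 <= K * #|successes C|).
Proof.
have [c0 constC] := constant_circuit.
have [c1 factC] : exists c, forall x : ('I_(size L) * {set J}) * (J * J),
    let d := nth Start L x.1.1 in
    agree (depth d) x.2.1 x.2.2 -> x.2.1 \in x.1.2 -> x.2.2 \notin x.1.2 ->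
    forall n (w : {ffun J -> 'I_(2 ^ n)}), (forall j, odd (w j)) ->
    exists2 C : circuit n.*2, circuit_size C <= n ^ c + c &
      forall uv, let p := nums (plug w x.2 uv) in
        outcome p d = subprod p x.1.2 -> circuit_num C (uv.1 * uv.2) = uv.1.
  apply: uniform_bound => [x c c' cc' H d sx aS bS n w ow|[[l S] [a b]]].
    have [C szC CE] := H sx aS bS n w ow.
    by exists C => //; apply: leq_trans szC (leq_exp_add _ cc').
  have [/and3P[sx aS bS]|H] :=
    boolP [&& agree (depth (nth Start L l)) a b, a \in S & b \notin S].
    by have [c H] := factor_circuit sx aS bS; exists c => d _ _ _; apply: H.
  by exists 0 => d sx aS bS; rewrite sx aS bS in H.
(* The summand 4 makes [n] at least 3 if there are more than [K] primes of
   length [n], so that all of them are odd. *)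
exists (#|event| + 4), (maxn c0 c1); split=> [|n]; first by rewrite addnS.
set P := primes_of_len n; set K := _ + 4.
have [n2|n2] := ltnP n 2.
  have [|C szC _] := constC n 0; first by rewrite expn_gt0.
  exists C; split=> //.
  by apply: leq_trans szC (leq_exp_add _ (leq_maxl _ _)).
have P0 : 0 < #|P| := primes_of_len_gt0 n2.
have [PK|KP] := leqP #|P| K.
  have [p0 p0P] := card_gt0P P0.
  have [C szC CE] := constC n p0 (ltn_ord _).
  exists C; split=> [|_];
    first by apply: leq_trans szC (leq_exp_add _ (leq_maxl _ _)).
  rewrite -mulnn leq_mul //.
  have <- : #|[set (p0, q) | q in P]| = #|P| by rewrite card_imset // =>
    q q' [].
  apply: subset_leq_card; apply/fintype.subsetP => _ /imsetP[q qP ->].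
  apply/setIdP; rewrite finset.in_setX p0P qP /= CE ?mem_head; first by split.
  by rewrite -addnn expnD ltn_mul.
have n3 : 2 < n.
  have : 2 ^ 2 < 2 ^ n.
    apply: leq_ltn_trans (leq_addl #|event| 4) _; apply: leq_trans KP _.
    by rewrite -[leqRHS]card_ord max_card.
  by rewrite ltn_exp2l.
have oddP p : p \in P -> odd p.
  rewrite primes_of_lenP ?(ltnW n2) // => /andP[pp np];
    case: (even_prime pp) => // p2.
  move: np; rewrite p2 => np; have : 2 ^ 3 <= 2 ^ n by rewrite leq_exp2l.
  by move/leq_trans/(_ np).
have [||e [w [wP pos_e H]]] := @averaging k _ P event positions (@occurs n) P0.
- by move=> [x|x] w /=; [case/and4P=> _ aS bS _; apply: contraNneq bS => <- |
  case/andP].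
- move=> w /ffun_onP wP; apply: some_event_occurs => j.
  by have := wP j; rewrite inE => /andP[].
case: e pos_e H => [[[l S] [a b]]|[a b]] /= nab H; last first.
  have: #|P| ^ 2 <= #|event| * #|P|.
    apply: leq_trans H _; rewrite leq_mul2l; apply/orP; right.
    apply: leq_trans (leq_imset_card (fun u => (u, u)) P).
    apply: subset_leq_card; apply/fintype.subsetP => -[u v].
    case/setIdP; rewrite finset.in_setX /plug !ffunE eqxx /= [b == a]eq_sym
      (negbTE nab) eqxx /=.
    by case/andP=> uP _ /eqP <-; apply/imsetP; exists u.
  by rewrite -mulnn leq_mul2r gtn_eqF //= leqNgt (leq_trans _ KP) // ltnS
    leq_addr.
have [/and3P[sx aS bS]|nx] :=
    boolP [&& agree (depth (nth Start L l)) a b, a \in S & b \notin S];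
      last first.
  move: H; rewrite [X in _ * X](_ : _ = 0) ?muln0 ?leqn0 ?expn_eq0 ?gtn_eqF //.
  apply/eqP; rewrite cards_eq0; apply/eqP/setP => uv; rewrite finset.in_set0.
  by apply/negbTE; apply: contra nx => /setIdP[_ /and4P[-> -> ->]].
have [C szC CE] := factC ((l, S), (a, b)) sx aS bS n w
  (fun j => oddP _ (ffun_onP wP j)).
exists C; split=> [|_];
  first by apply: leq_trans szC (leq_exp_add _ (leq_maxr _ _)).
apply: leq_trans H _; apply: leq_mul; first exact: leq_addr.
apply: subset_leq_card; apply/fintype.subsetP => uv.
move=> /setIdP[uvP /and4P[_ _ _ /eqP E]]; apply/setIdP; split=> //.
by rewrite (CE uv E) mem_head.
Qed.

End Factoring.

(** * Unprovability *)

Import Order.TTheory GRing.Theory Num.Theory.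

Theorem corollary3p11 (R : realType)
  (hard : forall (r : R) (C : forall n : nat, circuit n.*2),
     (0 < r)%R -> poly_size C ->
     exists n : nat, 2 <= n /\ (factor_prob R (C n) < r)%R)
  (one two : PV 0) (le dvd : PV 2)
  (hone : denotes one 1) (htwo : denotes two 2)
  (hle : expresses le leq) (hdvd : expresses dvd dvdn) :
  ~ proves T_PV (PrimeFactor one two le dvd).
Proof.
apply: unprovable_PrimeFactor => // L; apply: contrapT => no_run.
(* The tree needs a level below those at which the plays of the list are
   answered. *)
pose k := (foldr (fun d m => maxn (depth d) m) 0 L).+1.
have depth_lt d : List.In d L -> depth d < k.
  rewrite /k ltnS; elim: (L) => //= e s IH [->|/IH]; first exact: leq_maxl.
  by move/leq_trans; apply; apply: leq_maxr.
have [|K [c [K0 circuits]]] := @factoring_circuits k L.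
  move=> p inj_p prime_p; apply: contrapT => no_break; apply: no_run.
  exists (outcome p); split=> [||d dL]; first exact: run_outcome.
    rewrite /= /subprod (bigD1 [ffun=> false]) ?inE //=.
    apply: leq_trans (prime_gt1 (prime_p [ffun=> false])) (leq_pmulr _ _).
    by rewrite prodn_cond_gt0 // => j _; apply: prime_gt0.
  apply: (answer_refutes prime_p inj_p (y := outcome p d) (depth_lt d dL)).
  move=> S yE; apply: contrapT => /negP nS; apply: no_break.
  by exists d => //; exists S.
pose C n := projT1 (cid (circuits n)).
have HC n := projT2 (cid (circuits n)).
have [n [n2]] : exists n, 2 <= n /\ (factor_prob R (C n) < K%:R^-1)%R.
  apply: hard; first by rewrite invr_gt0 ltr0n.
  by exists c => n; case: (HC n).
have [_ /(_ n2) sK] := HC n.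
apply/negP; rewrite -leNgt /factor_prob -/(successes (C n)) cardsX mulnn.
rewrite ler_pdivlMr ?ltr0n ?expn_gt0 ?primes_of_len_gt0 //.
rewrite mulrC ler_pdivrMr ?ltr0n // -natrM ler_nat.
by rewrite mulnC.
Qed.
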